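(* Let $M\in\mathbb R^{n\times n}$ be sufficient, $Q\in\mathbb R^{n\times d}$ of rank $d$, $q\in\mathbb R^n$, $S=\{q+Q\theta:\theta\in\mathbb R^d\}$, $S^\epsilon=S+\boldsymbol\epsilon$, and let $V^\epsilon$, $E^\epsilon$, $V$ be as defined below. Let $B_1,B_2\in V$ be distinct with $\dim(S_{B_1}\cap S_{B_2})=d-1$. Then there exist $\tilde B^1,\dots,\tilde B^r\in V^\epsilon$ with $\tilde B^1=B_1$, $\tilde B^r=B_2$, $\{\tilde B^k,\tilde B^{k+1}\}\in E^\epsilon$ for $k=1,\dots,r-1$, and $\dim(S_{\tilde B^k}\cap S_{B_1}\cap S_{B_2})=d-1$ for all $k=1,\dots,r$.
   Context: $\boldsymbol\epsilon=(\epsilon,\epsilon^2,\dots,\epsilon^n)^T$. Let $A=[\,I\;\;-M\,]\in\mathbb R^{n\times 2n}$, columns indexed by $\{1,\dots,2n\}$; $A_{\cdot J}$ is the submatrix of columns indexed by $J$. Complementary index: $\bar i=i+n$ if $i\le n$, $\bar i=i-n$ if $i>n$. A set $J$ is complementary if $i\in J\Rightarrow\bar i\notin J$. A complementary basis is a complementary set $B$ with $|B|=n$ and $A_{\cdot B}$ invertible. Complementary cone: $\mathcal C(J)=\{A_{\cdot J}\lambda:\lambda\ge0\}$. Critical domain: $S_B=\mathcal C(B)\cap S$. Dimension of a convex set = dimension of its affine hull. $V^\epsilon$ is the set of complementary bases $B$ for which there is $\delta>0$ with $\dim(\mathcal C(B)\cap S^\epsilon)=d$ for all $\epsilon\in(0,\delta)$;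 $E^\epsilon$ is the set of pairs $\{B,B'\}$ of distinct elements of $V^\epsilon$ for which there is $\delta>0$ with $\dim(\mathcal C(B)\cap\mathcal C(B')\cap S^\epsilon)=d-1$ for all $\epsilon\in(0,\delta)$; $V=\{B\in V^\epsilon:\dim S_B=d\}$. $M$ is column sufficient if $[z_i(Mz)_i\le 0\ \forall i]\Rightarrow[z_i(Mz)_i=0\ \forall i]$; row sufficient if $M^T$ is column sufficient; sufficient if both. *)

(* Defs.v *)
From HB Require Import structures.
From mathcomp Require Import all_boot all_order all_algebra.
Set Implicit Arguments. Unset Strict Implicit. Unset Printing Implicit Defensive.
Import Order.TTheory GRing.Theory Num.Theory.
Local Open Scope ring_scope.

Section LCP.
Variable R : rcfType.

Definition column_sufficient n (M : 'M[R]_n) : Prop :=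
  forall z : 'cV[R]_n,
    (forall i, z i 0 * (M *m z) i 0 <= 0) -> (forall i, z i 0 * (M *m z) i 0 = 0).
Definition row_sufficient n (M : 'M[R]_n) : Prop := column_sufficient M^T.
Definition sufficient n (M : 'M[R]_n) : Prop := column_sufficient M /\ row_sufficient M.

Definition cset n := 'cV[R]_n -> Prop.
Definition csetI n (X Y : cset n) : cset n := fun x => X x /\ Y x.

(* affine dimension: dim X = dimension of the affine hull of X, i.e.
   -1 if X is empty, otherwise the largest m such that X contains
   m+1 affinely independent points x0, x0 + X_1, ..., x0 + X_m *)
Definition aff_indep_pts n (X : cset n) (m : nat) : Prop :=
  exists x0, X x0 /\ exists D : 'M[R]_(n, m),
    (forall j, X (x0 + col j D)) /\ \rank D = m.
Definition affdim n (X : cset n) (k : int) : Prop :=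
  (k = (-1)%R /\ ~ (exists x, X x)) \/
  (exists m : nat, k = m%:Z /\ aff_indep_pts X m /\ ~ aff_indep_pts X m.+1).

Definition Amat n (M : 'M[R]_n) : 'M[R]_(n, n + n) := row_mx 1%:M (- M).

Definition cmpl n (i : 'I_(n + n)) : 'I_(n + n) :=
  match split i with inl j => rshift n j | inr j => lshift n j end.

Definition complementary n (J : {set 'I_(n + n)}) : Prop :=
  forall i, i \in J -> cmpl i \notin J.

Definition Asub n (M : 'M[R]_n) (J : {set 'I_(n + n)}) : 'M[R]_(n, #|J|) :=
  \matrix_(i < n, k < #|J|) Amat M i (enum_val k).

Definition compl_basis n (M : 'M[R]_n) (B : {set 'I_(n + n)}) : Prop :=
  complementary B /\ #|B| = n /\
  exists C : 'M[R]_(#|B|, n), C *m Asub M B = 1%:M /\ Asub M B *m C = 1%:M.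

Definition ccone n (M : 'M[R]_n) (J : {set 'I_(n + n)}) : cset n :=
  fun x => exists lam : 'cV[R]_#|J|, (forall k, 0 <= lam k 0) /\ x = Asub M J *m lam.

Definition Sset n d (Q : 'M[R]_(n, d)) (q : 'cV[R]_n) : cset n :=
  fun x => exists theta : 'cV[R]_d, x = q + Q *m theta.
Definition epsvec n (e : R) : 'cV[R]_n := \col_(i < n) e ^+ i.+1.
Definition Seps n d (Q : 'M[R]_(n, d)) (q : 'cV[R]_n) (e : R) : cset n :=
  fun x => exists y, Sset Q q y /\ x = y + epsvec n e.

Definition critdom n d (M : 'M[R]_n) (Q : 'M[R]_(n, d)) (q : 'cV[R]_n)
  (B : {set 'I_(n + n)}) : cset n := csetI (ccone M B) (Sset Q q).

Definition inVeps n d (M : 'M[R]_n) (Q : 'M[R]_(n, d)) (q : 'cV[R]_n)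
  (B : {set 'I_(n + n)}) : Prop :=
  compl_basis M B /\
  exists delta : R, 0 < delta /\
    forall e : R, 0 < e -> e < delta ->
      affdim (csetI (ccone M B) (Seps Q q e)) d%:Z.

Definition inEeps n d (M : 'M[R]_n) (Q : 'M[R]_(n, d)) (q : 'cV[R]_n)
  (B B' : {set 'I_(n + n)}) : Prop :=
  B != B' /\ inVeps M Q q B /\ inVeps M Q q B' /\
  exists delta : R, 0 < delta /\
    forall e : R, 0 < e -> e < delta ->
      affdim (csetI (csetI (ccone M B) (ccone M B')) (Seps Q q e)) (d%:Z - 1).

Definition inV n d (M : 'M[R]_n) (Q : 'M[R]_(n, d)) (q : 'cV[R]_n)
  (B : {set 'I_(n + n)}) : Prop :=
  inVeps M Q q B /\ affdim (critdom M Q q B) d%:Z.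

End LCP.

(* Main.v *)
Require Import Defs.
From HB Require Import structures.
From mathcomp Require Import all_boot all_order all_algebra.
From mathcomp Require Import ring lra.
Set Implicit Arguments. Unset Strict Implicit. Unset Printing Implicit Defensive.
Import Order.TTheory GRing.Theory Num.Theory.
Local Open Scope ring_scope.

(** Take a generic point x of S_B1 ∩ S_B2 and a short segment of S near x, leading from the
    relative interior of S_B1 to that of S_B2, and translate it by the vector of powers of e.
    Two independent linear forms never vanish together on the translated line when e is small,
    because some combination of them is constant along the line and nonzero as a polynomial
    in e.  Hence the segment leaves the cone of a basis at a point where exactly one basic
    variable i vanishes.  With N the pivot transform of M at this basis, either N i i > 0 and
    i is exchanged with its complement, or N i i = 0 and sufficiency gives some j with
    N i j > 0 > N j i, and i, j are exchanged together, j being selected by a ratio test; row i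
    of N cannot be nonpositive since the endpoint lies in the cone of B2.  The new cone contains
    the next part of the segment and shares a facet with the old one.  Whether a given pair of
    bases is used in this way is decided by signs of polynomials in e, so the walk made for one
    small e gives edges for all small e.  All visited cones contain x, because they meet an
    arbitrarily small neighbourhood of x, and x was chosen so that a cone containing x meets
    S_B1 ∩ S_B2 in full dimension. *)

(** * Properties of all small positive e *)

Section Eventually.
Variable R : rcfType.

Definition ev (P : R -> Prop) : Prop :=
  exists delta : R, 0 < delta /\ forall e : R, 0 < e -> e < delta -> P e.

Lemma ev_mono (P Q : R -> Prop) :
  (forall e, 0 < e -> P e -> Q e) -> ev P -> ev Q.
Proof. by move=> h [d [d0 hd]]; exists d; split=> // e e0 ed; apply: h; auto. Qed.

Lemma ev_and (P Q : R -> Prop) : ev P -> ev Q -> ev (fun e => P e /\ Q e).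
Proof.
move=> [d [d0 hd]] [d' [d0' hd']]; exists (Num.min d d').
split; first by rewrite lt_min d0.
by move=> e e0; rewrite lt_min => /andP[h1 h2]; split; auto.
Qed.

Lemma ev_true (P : R -> Prop) : (forall e, P e) -> ev P.
Proof. by move=> p; exists 1; split. Qed.

Lemma ev_all (T : finType) (P : T -> R -> Prop) :
  (forall x, ev (P x)) -> ev (fun e => forall x, P x e).
Proof.
move=> h.
have [d hd] : exists d : T -> R, forall x, 0 < d x /\
    forall e, 0 < e -> e < d x -> P x e.
  (* Each bound is only known to exist, so the function [d] is assembled by induction along the
     enumeration of [T]. *)
  have : forall s : seq T, exists d : T -> R, forall x, x \in s -> 0 < d x /\
    forall e, 0 < e -> e < d x -> P x e.
    elim=> [|y s [d hd]]; first by exists (fun=> 1).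
    have [dy hdy] := h y.
    exists (fun x => if x == y then dy else d x) => x; rewrite inE.
    by case: eqP => [-> _|_ /= xs]; [exact: hdy | exact: hd].
  by move=> /(_ (enum T))[d hd]; exists d => x; apply: hd; rewrite mem_enum.
exists (\big[Num.min/1]_x d x); split.
  elim/big_ind: _ => // [a b a0 b0|x _]; first by rewrite lt_min a0.
  by have [] := hd x.
move=> e e0 ed x; have [_ hx] := hd x; apply: hx => //.
by apply: lt_le_trans ed _; apply: bigmin_le_cond.
Qed.

Lemma ev_witness (P : R -> Prop) : ev P -> exists e, 0 < e /\ P e.
Proof.
move=> [d [d0 hd]]; exists (d / 2); split; first by rewrite divr_gt0.
by apply: hd; lra.
Qed.

(** If [K] bounds the quotient by ['X] on the unit disk, the nonconstant part at [e] is at least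
    [- K * e], which the constant term outweighs for small [e]. *)
Lemma ev_poly_gt0 (p : {poly R}) : 0 < p.[0] -> ev (fun e => 0 < p.[e]).
Proof.
elim/poly_ind: p => [|p c _]; first by rewrite horner0 ltxx.
rewrite !hornerE => c0.
have [K hK] := poly_disk_bound p 1.
have K0 : 0 <= K by apply: le_trans (hK 0 _); rewrite ?normr0 ?normr_ge0.
(* The divisor is [K + 1] because [K] may be 0. *)
exists (Num.min 1 (c / (K + 1))); split.
  by rewrite lt_min ltr01 divr_gt0 //; lra.
move=> e e0; rewrite lt_min => /andP[e1]; rewrite ltr_pdivlMr; last by lra.
move=> eK; rewrite !hornerE.
have he : `|p.[e]| <= K by apply: hK; rewrite gtr0_norm // ltW.
move: he; rewrite ler_norml => /andP[h _].
have : - K * e <= p.[e] * e by rewrite ler_pM2r.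
by rewrite mulNr => h2; lra.
Qed.

(** Factors ['X], positive at [e], are stripped until the constant term is nonzero and decides the
    sign. *)
Lemma ev_poly_sign (p : {poly R}) : p != 0 ->
  ev (fun e => 0 < p.[e]) \/ ev (fun e => p.[e] < 0).
Proof.
elim/poly_ind: p => [|p c IH]; first by rewrite eqxx.
have [->|c0] := eqVneq c 0.
  rewrite addr0 => hp.
  have p0 : p != 0 by apply: contraNneq hp => ->; rewrite mul0r.
  have [h|h] := IH p0; [left|right]; apply: ev_mono h => e e0 h; rewrite hornerMX.
    by rewrite mulr_gt0.
  by rewrite pmulr_llt0.
move=> _; have [c1|c1|c1] := ltgtP 0 c; last by rewrite -c1 eqxx in c0.
  by left; apply: ev_poly_gt0; rewrite !hornerE.
right; have := @ev_poly_gt0 (- (p * 'X + c%:P)).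
rewrite !hornerE oppr_gt0 => /(_ c1); apply: ev_mono => e e0.
by rewrite hornerN oppr_gt0.
Qed.

(** Entry [i] of [epsvec] is [e ^+ i.+1], whence the factor ['X]; [insub] turns an exponent back
    into a column index. *)
Lemma epsvec_horner n (r : 'rV[R]_n) (c e : R) :
  c + (r *m epsvec n e) 0 0 = (c%:P + (\poly_(i < n) (if insub i is Some j then r 0 j else 0)) * 'X).[e].
Proof.
rewrite hornerD hornerC hornerMX horner_poly mxE mulr_suml; congr (_ + _).
by apply: eq_bigr => i _; rewrite mxE valK exprSr mulrA.
Qed.

Lemma ev_epsvec_gt0 n (r : 'rV[R]_n) (c : R) : 0 < c ->
  ev (fun e => 0 < c + (r *m epsvec n e) 0 0).
Proof.
move=> c0; pose p := \poly_(i < n) (if insub i is Some j then r 0 j else 0) : {poly R}.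
have : ev (fun e => 0 < (c%:P + p * 'X).[e]) by apply: ev_poly_gt0; rewrite !hornerE.
by apply: ev_mono => e _; rewrite epsvec_horner.
Qed.

(** The number [c] and the entries of [r] are coefficients in distinct degrees, so the polynomial in
    [e] is nonzero as soon as one of them is. This is the gain from perturbing by distinct
    powers. *)
Lemma ev_epsvec_sign n (r : 'rV[R]_n) (c : R) : (c != 0) || (r != 0) ->
  ev (fun e => 0 < c + (r *m epsvec n e) 0 0) \/
  ev (fun e => c + (r *m epsvec n e) 0 0 < 0).
Proof.
move=> h.
have [] := @ev_poly_sign
  (c%:P + (\poly_(i < n) (if insub i is Some j then r 0 j else 0)) * 'X).
- apply: contraTneq h => h; rewrite negb_or !negbK; apply/andP; split.
    by have := congr1 (fun p : {poly R} => p`_0) h; rewrite coefD coefC coefMX /= coef0 addr0 => ->.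
  apply/eqP/rowP => j.
  have := congr1 (fun p : {poly R} => p`_(j.+1)) h.
  by rewrite coefD coefC coefMX /= coef0 add0r coef_poly ltn_ord valK mxE.
- by move=> p; left; apply: ev_mono p => e _; rewrite -epsvec_horner.
- by move=> p; right; apply: ev_mono p => e _; rewrite -epsvec_horner.
Qed.

Lemma ev_epsvec_neq0 n (r : 'rV[R]_n) (c : R) : (c != 0) || (r != 0) ->
  ev (fun e => c + (r *m epsvec n e) 0 0 != 0).
Proof.
move=> /ev_epsvec_sign[]; apply: ev_mono => e _ h; first by rewrite gt_eqF.
by rewrite lt_eqF.
Qed.

Lemma ev_affine_gt0 (c b : R) : 0 < c -> ev (fun e => 0 < c + e * b).
Proof.
move=> c0; have : ev (fun e => 0 < (c%:P + b *: 'X).[e]).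
  by apply: ev_poly_gt0; rewrite !hornerE.
by apply: ev_mono => e _; rewrite !hornerE mulrC.
Qed.

End Eventually.

(** * Complementary bases as subsets of the n index pairs *)

Section Bases.
Variables (R : rcfType) (n : nat) (M : 'M[R]_n).

(* J is the set of those i for which the column of z_i, rather than w_i, is basic. *)
Definition basis_mx (J : {set 'I_n}) : 'M[R]_n :=
  \matrix_(i, j) (if j \in J then - M i j else (i == j)%:R).

Definition basis_set (J : {set 'I_n}) : {set 'I_(n + n)} :=
  [set k | match split k with inl j => j \notin J | inr j => j \in J end].

Definition pair_index (k : 'I_(n + n)) : 'I_n :=
  match split k with inl j => j | inr j => j end.

Definition basis_index (J : {set 'I_n}) (j : 'I_n) : 'I_(n + n) :=
  if j \in J then rshift n j else lshift n j.

Lemma split_lshift (j : 'I_n) : split (lshift n j) = inl j :> ('I_n + 'I_n).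
Proof. exact: (unsplitK (inl j)). Qed.
Lemma split_rshift (j : 'I_n) : split (rshift n j) = inr j :> ('I_n + 'I_n).
Proof. exact: (unsplitK (inr j)). Qed.

Lemma basis_index_in J j : basis_index J j \in basis_set J.
Proof.
rewrite inE /basis_index; case: (boolP (j \in J)) => h.
  by rewrite split_rshift.
by rewrite split_lshift.
Qed.

Lemma basis_indexK J : cancel (basis_index J) pair_index.
Proof.
move=> j; rewrite /basis_index /pair_index.
by case: ifP => _; rewrite ?split_rshift ?split_lshift.
Qed.

Lemma pair_indexK J k : k \in basis_set J -> basis_index J (pair_index k) = k.
Proof.
rewrite inE /basis_index /pair_index.
by have := splitK k; case: (split k) => j /= <-; [move=> /negbTE-> | move=> ->].
Qed.

Lemma card_basis_set J : #|basis_set J| = n.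
Proof.
have -> : basis_set J = [set basis_index J j | j : 'I_n].
  apply/setP => k; apply/idP/imsetP => [h|[j _ ->]]; last exact: basis_index_in.
  by exists (pair_index k); rewrite ?pair_indexK.
by rewrite card_imset ?card_ord //; apply: can_inj (basis_indexK J).
Qed.

Lemma basis_set_inj : injective basis_set.
Proof.
move=> J J' h; apply/setP => j; have : (rshift n j \in basis_set J) = (rshift n j \in basis_set J') by rewrite h.
by rewrite !inE split_rshift.
Qed.

Lemma Amat_basis_index J i j : Amat M i (basis_index J j) = basis_mx J i j.
Proof.
rewrite /Amat /basis_index !mxE.
by case: ifP => _; rewrite ?split_rshift ?split_lshift !mxE.
Qed.

(** [Asub] orders columns by the enumeration of the set, [basis_mx] by pair index; the sum is
    reindexed from one order to the other. *)
Lemma Asub_mul J p (L : 'M[R]_(#|basis_set J|, p)) :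
  Asub M (basis_set J) *m L =
  basis_mx J *m \matrix_(j, l)
     L (enum_rank_in (basis_index_in J j) (basis_index J j)) l.
Proof.
apply/matrixP => i l; rewrite [LHS]mxE [RHS]mxE.
rewrite (reindex (fun j => enum_rank_in (basis_index_in J j) (basis_index J j))) /=.
  apply: eq_bigr => j _; rewrite [Asub _ _ _ _]mxE [(\matrix_(_, _) L _ _) _ _]mxE.
  by rewrite enum_rankK_in ?basis_index_in // Amat_basis_index.
exists (fun k => pair_index (enum_val k)) => [j _|k _].
  by rewrite enum_rankK_in ?basis_index_in // basis_indexK.
apply: enum_val_inj; rewrite enum_rankK_in ?basis_index_in //.
by rewrite pair_indexK ?enum_valP.
Qed.

Lemma ccone_basis_set J x : ccone M (basis_set J) x <->
  exists f : 'cV[R]_n, (forall k, 0 <= f k 0) /\ x = basis_mx J *m f.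
Proof.
split=> [[lam [h ->]]|[f [h ->]]].
  rewrite Asub_mul; eexists; split; last reflexivity.
  by move=> k; rewrite mxE.
exists (\col_k f (pair_index (enum_val k)) 0); split.
  by move=> k; rewrite mxE.
rewrite Asub_mul; congr (_ *m _); apply/colP => j; rewrite !mxE.
by rewrite enum_rankK_in ?basis_index_in // basis_indexK.
Qed.

Lemma ccone_unit J x : basis_mx J \in unitmx ->
  ccone M (basis_set J) x <-> forall k, 0 <= (invmx (basis_mx J) *m x) k 0.
Proof.
move=> uJ; rewrite ccone_basis_set; split=> [[f [h ->]] k|h].
  by rewrite mulKmx.
by exists (invmx (basis_mx J) *m x); rewrite mulKVmx.
Qed.

Lemma compl_basis_set J : basis_mx J \in unitmx -> compl_basis M (basis_set J).
Proof.
move=> uJ; split.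
  move=> k; rewrite !inE /cmpl; case: (split k) => j h.
    by rewrite split_rshift.
  by rewrite split_lshift h.
split; first exact: card_basis_set.
exists (\matrix_(k, l) invmx (basis_mx J) (pair_index (enum_val k)) l); split.
  apply/matrixP => k l; rewrite [LHS]mxE [RHS]mxE.
  have := congr1 (fun A : 'M[R]_n => A (pair_index (enum_val k)) (pair_index (enum_val l)))
     (mulVmx uJ).
  rewrite [LHS]mxE [RHS]mxE => E.
  have -> : (k == l) = (pair_index (enum_val k) == pair_index (enum_val l)).
    apply/eqP/eqP => [->//|E2]; apply: enum_val_inj.
    by rewrite -[LHS](pair_indexK (enum_valP k)) E2 pair_indexK ?enum_valP.
  rewrite -E; apply: eq_bigr => i _.
  by rewrite [Asub _ _ _ _]mxE -Amat_basis_index pair_indexK ?enum_valP // [X in X * _]mxE.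
rewrite Asub_mul -[RHS](mulmxV uJ); congr (_ *m _); apply/matrixP => j l; rewrite !mxE.
by rewrite enum_rankK_in ?basis_index_in // basis_indexK.
Qed.

(** Complementarity makes [pair_index] injective on [B]; since [B] has n elements it is also onto,
    so [B] takes exactly one index from each pair. *)
Lemma compl_basis_witness (B : {set 'I_(n + n)}) : compl_basis M B ->
  exists J, B = basis_set J /\ basis_mx J \in unitmx.
Proof.
move=> [cB [nB [C [_ hC]]]].
pose J := [set j | rshift n j \in B].
have inj : {in B &, injective pair_index}.
  move=> k l kB lB; rewrite /pair_index; have := cB k kB; rewrite /cmpl.
  have := splitK k; have := splitK l.
  case: (split k) => a; case: (split l) => b /= El Ek h E; subst a;
    by [rewrite -Ek -El | rewrite El lB in h].
have im : pair_index @: B = setT.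
  by apply/eqP; rewrite eqEcard subsetT cardsT card_ord card_in_imset // nB leqnn.
have EB : B = basis_set J.
  apply/setP => k; rewrite inE.
  have := splitK k; case: (split k) => a /= <-; last by rewrite inE.
  rewrite inE; apply/idP/idP => [h|h].
    by have := cB _ h; rewrite /cmpl split_lshift.
  have : a \in pair_index @: B by rewrite im inE.
  move=> /imsetP[l lB]; rewrite /pair_index; have := splitK l.
  by case: (split l) => b /= El E; [rewrite E El | rewrite E El lB in h].
exists J; split=> //.
move: C hC; rewrite EB => C; rewrite Asub_mul => /mulmx1_unit[]//.
Qed.

End Bases.

(** * Sufficient matrices and pivots *)

Section Sufficiency.
Variable R : rcfType.

Lemma mulmx_delta n p (A : 'M[R]_(p, n)) (a : R) i k :
  (A *m (a *: delta_mx i 0 : 'cV_n)) k 0 = a * A k i.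
Proof. by rewrite -scalemxAr -colE mxE [col _ _ _ _]mxE. Qed.

Lemma scale_deltaE n (a : R) (i k : 'I_n) :
  (a *: delta_mx i 0 : 'cV_n) k 0 = a * (k == i)%:R.
Proof. by rewrite !mxE eqxx andbT. Qed.

Lemma column_sufficient_diag_ge0 n (N : 'M[R]_n) i :
  column_sufficient N -> 0 <= N i i.
Proof.
move=> sN; rewrite leNgt; apply/negP => lt0.
have := sN (1 *: delta_mx i 0).
have E k : (1 *: delta_mx i 0 : 'cV[R]_n) k 0 = (k == i)%:R.
  by rewrite scale1r mxE eqxx andbT.
move=> /(_ _ i); rewrite E mulmx_delta eqxx !mul1r => h.
suff : N i i = 0 by lra.
apply: h => k; rewrite E mulmx_delta.
by case: eqP => [->|_]; rewrite ?mul0r ?mul1r // ltW.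
Qed.

(** The test vector is [l e_i + e_j], with [l] chosen so that entry [j] of its image is -1. If
    [N i j * N j i] were nonnegative, the product at [i] would be nonpositive, and the product -1 at
    [j] would contradict sufficiency. *)
Lemma column_sufficient_offdiag n (N : 'M[R]_n) i j :
  column_sufficient N -> N i i = 0 -> i != j -> N j i != 0 -> N i j * N j i < 0.
Proof.
move=> sN Nii ij Nji; rewrite ltNge; apply/negP => ge0.
have Njj : 0 <= N j j by apply: column_sufficient_diag_ge0.
pose l := - (N j j + 1) / N j i.
pose z : 'cV[R]_n := l *: delta_mx i 0 + 1 *: delta_mx j 0.
have zE k : z k 0 = l * (k == i)%:R + (k == j)%:R.
  by rewrite !mxE !eqxx !andbT mul1r.
have NzE k : (N *m z) k 0 = l * N k i + N k j.
  by rewrite mulmxDr mxE !mulmx_delta mul1r.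
have lE : l * N j i = - (N j j + 1) by rewrite /l divfK.
have := sN z _ j.
rewrite zE NzE eqxx (eq_sym j) (negbTE ij) mulr0 add0r mul1r lE => h.
suff : - (N j j + 1) + N j j = 0 by lra.
apply: h => k; rewrite zE NzE.
have [->|ki] := eqVneq k i.
  rewrite (negbTE ij) addr0 mulr1 Nii mulr0 add0r.
  have -> : l * N i j = - (N j j + 1) * (N i j * N j i) * (N j i)^-1 ^+ 2.
    by rewrite /l; field.
  rewrite mulNr mulNr oppr_le0; apply: mulr_ge0 (sqr_ge0 _); apply: mulr_ge0 => //.
  exact: addr_ge0.
rewrite mulr0 add0r; have [->|_] := eqVneq k j; last by rewrite mul0r.
by rewrite lE /= mul1r; lra.
Qed.

Lemma unitmx_surjective n (A : 'M[R]_n) :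
  (forall x : 'cV_n, exists y, A *m y = x) -> A \in unitmx.
Proof.
move=> h; rewrite -unitmx_tr -row_full_unit -sub1mx; apply/row_subP => i.
have [y hy] := h (col i 1%:M); apply/submxP; exists y^T.
by rewrite -trmx_mul hy tr_col trmx1.
Qed.

End Sufficiency.

Section Pivots.
Variables (R : rcfType) (n : nat) (M : 'M[R]_n).
Implicit Types J F : {set 'I_n}.

(* A vector x is basis_mx J *m w + basis_mx (~: J) *m z iff w = c + pivot_mx J *m z, where
   c are the coordinates of x in basis J. *)
Definition pivot_mx J : 'M[R]_n :=
  - (invmx (basis_mx M J) *m basis_mx M (~: J)).

Definition select J (a b : 'cV[R]_n) : 'cV[R]_n :=
  \col_i (if i \in J then a i 0 else b i 0).

(** The combination takes the form [W - M *m Z]: on [J] the basic value belongs to [Z] and the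
    nonbasic one to [W], off [J] the reverse. *)
Lemma basis_mx_select J w z :
  basis_mx M J *m w + basis_mx M (~: J) *m z = select J z w - M *m select J w z.
Proof.
apply/colP => i; rewrite !mxE.
have -> : (if i \in J then z i 0 else w i 0) =
    \sum_j (i == j)%:R * (if j \in J then z j 0 else w j 0).
  rewrite (bigD1 i) //= eqxx mul1r big1 ?addr0 // => j.
  by rewrite eq_sym => /negbTE->; rewrite mul0r.
rewrite -big_split -sumrB; apply: eq_bigr => j _; rewrite !mxE inE.
by case: (j \in J) => /=; ring.
Qed.

Lemma pivot_mx_eq J (x z : 'cV[R]_n) : basis_mx M J \in unitmx ->
  basis_mx M J *m (invmx (basis_mx M J) *m x + pivot_mx J *m z)
  + basis_mx M (~: J) *m z = x.
Proof.
move=> uJ; rewrite mulmxDr mulKVmx // /pivot_mx mulNmx mulmxN -mulmxA mulKVmx //.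
by rewrite subrK.
Qed.

(** Exchanging a variable with its complement does not change their product, so the componentwise
    products for [pivot_mx J] are products for [M]. *)
Lemma pivot_mx_sufficient J : basis_mx M J \in unitmx ->
  sufficient M -> sufficient (pivot_mx J).
Proof.
move=> uJ [cM rM]; split.
  move=> z hz; set w := pivot_mx J *m z.
  have E : select J z w = M *m select J w z.
    apply/eqP; rewrite -subr_eq0 -basis_mx_select.
    by have := pivot_mx_eq 0 z uJ; rewrite mulmx0 add0r => ->.
  have P i : (select J w z) i 0 * (M *m select J w z) i 0 = z i 0 * w i 0.
    by rewrite -E !mxE; case: ifP; rewrite // mulrC.
  by move=> i; rewrite -P; apply: cM => k; rewrite P.
move=> v hv.
(* For the transpose, the entries of [v] and of its image are [u k] and [(M^T *m u) k] in some
   order, up to signs that cancel in the product. *)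
pose u := (invmx (basis_mx M J))^T *m v.
have Ev : v = (basis_mx M J)^T *m u.
  by rewrite mulmxA -trmx_mul mulVmx // trmx1 mul1mx.
have En : (pivot_mx J)^T *m v = - ((basis_mx M (~: J))^T *m u).
  by rewrite /pivot_mx linearN /= trmx_mul mulNmx mulmxA.
have T K k : ((basis_mx M K)^T *m u) k 0 = if k \in K then - (M^T *m u) k 0 else u k 0.
  rewrite [LHS]mxE; case: ifP => kK.
    rewrite [(M^T *m u) k 0]mxE -sumrN; apply: eq_bigr => j _.
    by rewrite [X in X * _ = _]mxE [basis_mx _ _ _ _]mxE kK [M^T _ _]mxE mulNr.
  rewrite (bigD1 k) //= [X in X * _ + _]mxE [basis_mx _ _ _ _]mxE kK eqxx mul1r.
  rewrite big1 ?addr0 // => j /negbTE jk.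
  by rewrite [_^T _ _]mxE [basis_mx _ _ _ _]mxE kK jk mul0r.
have P i : v i 0 * ((pivot_mx J)^T *m v) i 0 = u i 0 * (M^T *m u) i 0.
  rewrite En {1}Ev [(- (_ *m u)) i 0]mxE !T inE.
  by case: (i \in J) => /=; ring.
by move=> i; rewrite P; apply: rM => k; rewrite -P.
Qed.

Definition flip J F : {set 'I_n} := [set k | (k \in J) (+) (k \in F)].

(** Under the two vanishing conditions, only columns of the flipped basis remain in the expansion of
    [x]. *)
Lemma flip_coords J F (x z : 'cV[R]_n) : basis_mx M J \in unitmx ->
  let w := invmx (basis_mx M J) *m x + pivot_mx J *m z in
  (forall k, k \notin F -> z k 0 = 0) -> (forall k, k \in F -> w k 0 = 0) ->
  basis_mx M (flip J F) *m select F z w = x.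
Proof.
move=> uJ w z0 w0; rewrite -[RHS](pivot_mx_eq x z uJ) -/w basis_mx_select.
clearbody w.
have -> : basis_mx M (flip J F) *m select F z w =
  basis_mx M (flip J F) *m select F z w + basis_mx M (~: flip J F) *m 0.
  by rewrite mulmx0 addr0.
rewrite basis_mx_select; congr (_ - M *m _); apply/colP => k; rewrite !mxE inE.
  by case: (boolP (k \in F)) => kF; case: (k \in J) => //=; rewrite ?z0 ?w0.
by case: (boolP (k \in F)) => kF; case: (k \in J) => //=; rewrite ?z0 ?w0.
Qed.

Definition bcoord J k (x : 'cV[R]_n) : R := (invmx (basis_mx M J) *m x) k 0.

(** [zf x] holds the values of the entering variables that bring the coordinates in [F] to 0. Every
    [x] is then a combination of the new columns, which gives invertibility, and the new coordinates
    are read off. *)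
Lemma flip_pivot J F (zf : 'cV[R]_n -> 'cV[R]_n) : basis_mx M J \in unitmx ->
  (forall x k, k \notin F -> zf x k 0 = 0) ->
  (forall x k, k \in F -> bcoord J k x + (pivot_mx J *m zf x) k 0 = 0) ->
  basis_mx M (flip J F) \in unitmx /\
  forall x k, bcoord (flip J F) k x =
    if k \in F then zf x k 0 else bcoord J k x + (pivot_mx J *m zf x) k 0.
Proof.
move=> uJ h1 h2.
have E x : basis_mx M (flip J F) *m
    select F (zf x) (invmx (basis_mx M J) *m x + pivot_mx J *m zf x) = x.
  by apply: flip_coords => // [k /h1//|k /(h2 x) <-]; rewrite mxE.
have uF : basis_mx M (flip J F) \in unitmx.
  by apply: unitmx_surjective => x; eexists; exact: E.
split=> // x k; rewrite {1}/bcoord -{1}(E x) mulKmx // !mxE.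
by rewrite /bcoord; case: ifP => // _; rewrite !mxE.
Qed.

(** The factor [- g] puts the two cones on opposite sides of one hyperplane, which carries facet [i]
    of the first and facet [i'] of the second. *)
Definition adjacent J J' i i' : Prop :=
  [/\ basis_mx M J \in unitmx, basis_mx M J' \in unitmx, J != J' &
   exists g, 0 < g /\ forall x, bcoord J' i' x = - g * bcoord J i x].

Lemma flip_neq J F i : i \in F -> J != flip J F.
Proof.
move=> iF; apply/eqP => /setP/(_ i); rewrite inE iF.
by case: (i \in J).
Qed.

(** [i'] is the index whose new coordinate vanishes at [y]: [i] after a single exchange, [j] after a
    double one. The last hypothesis excludes ties in the ratio test. *)
Lemma pivot_step J i y : sufficient M -> basis_mx M J \in unitmx ->
  bcoord J i y = 0 -> (forall k, k != i -> 0 < bcoord J k y) ->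
  (exists j, 0 < pivot_mx J i j) ->
  (forall k l, k != l -> k != i -> l != i ->
     pivot_mx J k i < 0 -> pivot_mx J l i < 0 ->
     pivot_mx J l i * bcoord J k y - pivot_mx J k i * bcoord J l y != 0) ->
  exists J' i', adjacent J J' i i' /\ forall k, k != i' -> 0 < bcoord J' k y.
Proof.
move=> sM uJ yi yk [j0 hj0] ties.
have [cN rN] := pivot_mx_sufficient uJ sM.
set N := pivot_mx J in hj0 ties cN rN.
have tE a b : N^T a b = N b a by rewrite mxE.
have Nii : 0 <= N i i by apply: column_sufficient_diag_ge0.
rewrite le_eqVlt in Nii; case/predU1P: Nii => [/esym Nii | Nii]; last first.
  have [] := @flip_pivot J [set i] (fun x => (- bcoord J i x / N i i) *: delta_mx i 0) uJ.
  - by move=> x k; rewrite inE scale_deltaE => /negbTE->; rewrite mulr0.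
  - move=> x k; rewrite inE => /eqP->; rewrite mulmx_delta -/N.
    by field; rewrite gt_eqF.
  move=> uJ' cE.
  exists (flip J [set i]), i; split.
    split=> //; first by apply: (@flip_neq _ _ i); rewrite inE.
    exists (N i i)^-1; rewrite invr_gt0; split=> // x.
    by rewrite cE inE eqxx scale_deltaE eqxx mulr1; field; rewrite gt_eqF.
  move=> k ki; rewrite cE inE (negbTE ki) mulmx_delta yi oppr0 !mul0r addr0.
  exact: yk.
(* Zero diagonal: row sufficiency gives [N j0 i < 0], so the ratio test has a candidate; column
   sufficiency then gives [0 < N i j] at the minimiser [j]. *)
have ij0 : i != j0 by apply: contraTneq hj0 => <-; rewrite Nii ltxx.
have hj0' : N j0 i < 0.
  have := @column_sufficient_offdiag _ _ N^T i j0 rN.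
  rewrite !tE => /(_ Nii ij0); rewrite gt_eqF // => /(_ isT).
  by rewrite pmulr_llt0.
pose P := [pred k | N k i < 0].
pose ratio k := bcoord J k y / - N k i.
have [j Pj minj] := @arg_minP _ R _ j0 P ratio hj0'.
have {Pj} Nji : N j i < 0 by [].
have ji : j != i by apply: contraTneq Nji => ->; rewrite Nii ltxx.
have ij : i != j by rewrite eq_sym.
have Nij : 0 < N i j.
  have := @column_sufficient_offdiag _ _ N i j cN Nii ij.
  rewrite lt_eqF // => /(_ isT); by rewrite nmulr_llt0.
(* [zj] cancels coordinate [i], which [zi] does not affect as [N i i = 0]; then [zi] cancels
   coordinate [j]. At [y], [zj] is 0 and [zi] is the minimal ratio. *)
pose zj x := - bcoord J i x / N i j.
pose zi x := - (bcoord J j x + N j j * zj x) / N j i.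
pose zf x : 'cV[R]_n := zi x *: delta_mx i 0 + zj x *: delta_mx j 0.
have zfE x k : zf x k 0 = zi x * (k == i)%:R + zj x * (k == j)%:R.
  by rewrite [LHS]mxE !scale_deltaE.
have NzE x k : (N *m zf x) k 0 = zi x * N k i + zj x * N k j.
  by rewrite mulmxDr mxE !mulmx_delta.
have [] := @flip_pivot J [set i; j] zf uJ.
- move=> x k; rewrite !inE negb_or zfE => /andP[/negbTE-> /negbTE->].
  by rewrite !mulr0 addr0.
- move=> x k; rewrite !inE NzE => /orP[] /eqP->.
    by rewrite Nii /zj; field; rewrite gt_eqF.
  by rewrite /zi; field; rewrite lt_eqF.
move=> uJ' cE.
exists (flip J [set i; j]), j; split.
  split=> //; first by apply: (@flip_neq _ _ i); rewrite !inE eqxx.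
  exists (N i j)^-1; rewrite invr_gt0; split=> // x.
  rewrite cE !inE eqxx orbT zfE eqxx (negbTE ji) mulr0 mulr1 add0r /zj.
  by field; rewrite gt_eqF.
have zjy : zj y = 0 by rewrite /zj yi oppr0 mul0r.
have ziy : zi y = bcoord J j y / - N j i.
  by rewrite /zi zjy mulr0 addr0 mulNr invrN mulrN.
have zi0 : 0 < zi y by rewrite ziy divr_gt0 ?oppr_gt0 // yk.
move=> k kj; rewrite cE !inE (negbTE kj) orbF.
have [->|ki] := eqVneq k i.
  by rewrite zfE eqxx (negbTE ij) mulr1 mulr0 addr0.
rewrite -/N NzE zjy mul0r addr0.
have [Nki|Nki] := lerP 0 (N k i).
  by apply: ltr_wpDr; [rewrite mulr_ge0 // ltW | exact: yk].
have := minj k Nki; rewrite /ratio -ziy ler_pdivlMr ?oppr_gt0 // => h.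
have := ties k j kj ki ji Nki Nji => t.
(* Minimality gives the weak inequality; equality would be a tie. *)
rewrite lt_neqAle; apply/andP; split; last by lra.
apply: contraNneq t => t.
have : bcoord J j y = - (zi y * N j i) by rewrite ziy; field; rewrite lt_eqF.
by move=> ->; apply/eqP; nra.
Qed.

(** The two complementary representations of [y] differ by a vector whose products with its image
    are at most 0, hence 0 by sufficiency. So a [J']-coordinate vanishes wherever [J] and [J']
    differ. *)
Lemma bcoord_uniq J J' y : column_sufficient M ->
  basis_mx M J \in unitmx -> basis_mx M J' \in unitmx ->
  (forall k, 0 < bcoord J k y) -> (forall k, 0 <= bcoord J' k y) -> J = J'.
Proof.
move=> cM uJ uJ' h h'.
pose w K (f : 'cV[R]_n) := select K 0 f. pose z K (f : 'cV[R]_n) := select K f 0.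
have E K : basis_mx M K \in unitmx ->
    y = w K (\col_k bcoord K k y) - M *m z K (\col_k bcoord K k y).
  move=> uK; rewrite -basis_mx_select mulmx0 addr0.
  have -> : \col_k bcoord K k y = invmx (basis_mx M K) *m y.
    by apply/colP => k; rewrite mxE.
  by rewrite mulKVmx.
set f := \col_k bcoord J k y in E; set f' := \col_k bcoord J' k y in E.
have D : M *m (z J f - z J' f') = w J f - w J' f'.
  have e : w J f - M *m z J f = w J' f' - M *m z J' f' by rewrite -!E.
  have -> : w J f = w J' f' - M *m z J' f' + M *m z J f by rewrite -e subrK.
  by rewrite mulmxBr; apply/colP => k; rewrite !mxE; ring.
have P k : (z J f - z J' f') k 0 * (M *m (z J f - z J' f')) k 0 =
    if (k \in J) == (k \in J') then 0 else - (bcoord J k y * bcoord J' k y).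
  rewrite D !mxE.
  by case: (k \in J); case: (k \in J') => /=; ring.
have S k : (k \in J) != (k \in J') -> bcoord J' k y = 0.
  move=> kJ; have := cM (z J f - z J' f') _ k.
  rewrite P (negbTE kJ) => H; have fk := h k.
  have /eqP : - (bcoord J k y * bcoord J' k y) = 0.
    apply: H => l; rewrite P; case: ifP => // _.
    by rewrite oppr_le0 mulr_ge0 // ltW.
  by rewrite oppr_eq0 mulf_eq0 (gt_eqF fk) => /eqP.
(* Vanishing where [J] and [J'] differ, [f'] represents [y] in basis [J] too; the coordinates agree,
   and a positive one cannot vanish. *)
have Ef : y = basis_mx M J *m f'.
  rewrite (E J' uJ') -/f' -[RHS]addr0 -(mulmx0 _ (basis_mx M (~: J))) basis_mx_select.
  have agree (a b : 'cV[R]_n) : (forall k, bcoord J' k y = 0 -> a k 0 = b k 0) ->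
      select J' a b = select J a b.
    move=> ab; apply/colP => k; rewrite !mxE.
    have := S k; case: (k \in J); case: (k \in J') => //= /(_ isT) /ab -> //.
  by rewrite /w /z !agree // => k e; rewrite !mxE e.
apply/setP => k; apply/eqP; apply: contraT => /S.
have -> : bcoord J' k y = bcoord J k y.
  by rewrite [RHS]/bcoord [in RHS]Ef mulKmx // [RHS]mxE.
by move=> e; have := h k; rewrite e ltxx.
Qed.

End Pivots.

(** * The walk along a generic segment *)

Inductive linked (T : Type) (V : T -> Prop) (E : T -> T -> Prop) : T -> T -> Prop :=
| linked0 x : V x -> linked V E x x
| linkedS x y z : V x -> E x y -> linked V E y z -> linked V E x z.

Lemma linked_seq (T : Type) (V : T -> Prop) (E : T -> T -> Prop) x z :
  linked V E x z -> exists (r : nat) (b : nat -> T),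
    [/\ (0 < r)%N, b 0%N = x, b r.-1 = z, (forall k, (k < r)%N -> V (b k)) &
        forall k, (k.+1 < r)%N -> E (b k) (b k.+1)].
Proof.
elim=> [{}x Vx|{}x y {}z Vx Exy _ [r [b [r0 b0 br bV bE]]]].
  by exists 1%N, (fun=> x); split.
exists r.+1, (fun k => if k is k'.+1 then b k' else x); split=> //=.
- by case: r r0 br {bV bE}.
- by case.
- by case=> [|k] h; [rewrite b0 | exact: bE].
Qed.

Section Walk.
Variables (R : rcfType) (n : nat) (M : 'M[R]_n).
Implicit Types J : {set 'I_n}.

Lemma bcoordD J k x y : bcoord M J k (x + y) = bcoord M J k x + bcoord M J k y.
Proof. by rewrite /bcoord mulmxDr mxE. Qed.

Lemma bcoordZ J k a x : bcoord M J k (a *: x) = a * bcoord M J k x.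
Proof. by rewrite /bcoord -scalemxAr mxE. Qed.

Lemma ccone_bcoord J y : basis_mx M J \in unitmx -> (forall k, 0 <= bcoord M J k y) ->
  exists w z : 'cV[R]_n, [/\ forall k, 0 <= w k 0, forall k, 0 <= z k 0 & y = w - M *m z].
Proof.
move=> uJ h; exists (select J 0 (invmx (basis_mx M J) *m y)),
  (select J (invmx (basis_mx M J) *m y) 0); split=> [k|k|].
- by rewrite mxE; case: ifP => _; [rewrite mxE | exact: h].
- by rewrite mxE; case: ifP => _; [exact: h | rewrite mxE].
by rewrite -basis_mx_select mulmx0 addr0 mulKVmx.
Qed.

(* If row i were nonpositive, the i-th coordinate would be nonnegative on every complementary
   cone. *)
Lemma exit_pivot_pos J J' i y : basis_mx M J \in unitmx ->
  basis_mx M J' \in unitmx -> (forall k, 0 <= bcoord M J' k y) -> bcoord M J i y < 0 ->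
  exists j, 0 < pivot_mx M J i j.
Proof.
move=> uJ uJ' y0 yi; apply/existsP; apply: contraT; rewrite negb_exists => /forallP N0.
have [w [z [w0 z0 Ey]]] := ccone_bcoord uJ' y0.
(* [u] and [v] are the nonnegative basic and nonbasic values relative to [J]. *)
pose u := select J z w; pose v := select J w z.
have Eu : y = basis_mx M J *m u + basis_mx M (~: J) *m v.
  rewrite basis_mx_select Ey; congr (_ - M *m _); apply/colP => k; rewrite !mxE;
  by case: (k \in J).
have : bcoord M J i y = u i 0 - (pivot_mx M J *m v) i 0.
  by rewrite /bcoord Eu mulmxDr mulKmx // mulmxA /pivot_mx mulNmx !mxE opprK.
move=> E; move: yi; rewrite E ltNge => /negP[].
rewrite subr_ge0; apply: (@le_trans _ _ 0).
  rewrite mxE; apply: sumr_le0 => j _; rewrite mulr_le0_ge0 //.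
    by rewrite leNgt N0.
  by rewrite mxE; case: ifP.
by rewrite mxE; case: ifP.
Qed.

Variables (y0 U : 'cV[R]_n).
Hypothesis sM : sufficient M.
Local Notation y t := (y0 + t *: U).

(** The first clause lets the line meet facets only one at a time; the second is the absence of ties
    required by [pivot_step]. *)
Definition generic_line : Prop :=
  forall J i (t : R), basis_mx M J \in unitmx -> bcoord M J i (y t) = 0 ->
  (forall k, k != i -> bcoord M J k (y t) != 0) /\
  forall k l, k != l -> k != i -> l != i ->
    pivot_mx M J k i < 0 -> pivot_mx M J l i < 0 ->
    pivot_mx M J l i * bcoord M J k (y t) - pivot_mx M J k i * bcoord M J l (y t) != 0.

Hypothesis gen : generic_line.

(** Under [adjacent], coordinate [i'] of [J'] vanishes at [p] together with coordinate [i] of [J],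
    so [p] is relatively interior to the common facet. *)
Definition facet_point J J' i i' (p : 'cV[R]_n) : Prop :=
  [/\ bcoord M J i p = 0, forall k, k != i -> 0 < bcoord M J k p &
      forall k, k != i' -> 0 < bcoord M J' k p].

Definition meets_segment J : Prop :=
  basis_mx M J \in unitmx /\
  exists t : R, [/\ 0 <= t, t <= 1 & forall k, 0 <= bcoord M J k (y t)].

Definition crossing J J' : Prop :=
  exists i i' (t : R), [/\ adjacent M J J' i i', bcoord M J i U < 0 & facet_point J J' i i' (y t)].

Variable J2 : {set 'I_n}.
Hypothesis uJ2 : basis_mx M J2 \in unitmx.
Hypothesis endJ2 : forall k, 0 < bcoord M J2 k (y 1).

(** The number of pairs whose value exceeds the current [t] is the termination measure of the
    walk. *)
Let breakpoint (s : {set 'I_n} * 'I_n) : R :=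
  - bcoord M s.1 s.2 y0 / bcoord M s.1 s.2 U.

Let bcoord_line J k t : bcoord M J k (y t) = bcoord M J k y0 + t * bcoord M J k U.
Proof. by rewrite bcoordD bcoordZ. Qed.

(** Invariant: the current point lies in the cone of [J], and each coordinate vanishing there
    increases along [U], so the cone contains the next part of the segment. *)
Lemma walk_segment J (t : R) : basis_mx M J \in unitmx -> 0 <= t -> t < 1 ->
  (forall k, 0 <= bcoord M J k (y t) /\ (bcoord M J k (y t) = 0 -> 0 < bcoord M J k U)) ->
  linked meets_segment crossing J J2.
Proof.
have [m] := ubnP #|[pred s | t < breakpoint s]|.
elim: m J t => // m IH J t; rewrite ltnS => Hm uJ t0 t1 st.
have VJ : meets_segment J.
  by split=> //; exists t; split=> //; [exact: ltW | move=> k; have [] := st k].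
(* The endpoint is interior to the cone of [J2]; if it also lies in that of [J], then [J = J2]. *)
have [/forallP all1|] := boolP [forall k, 0 <= bcoord M J k (y 1)].
  by rewrite -(bcoord_uniq sM.1 uJ2 uJ endJ2 all1) in VJ *; exact: linked0.
rewrite negb_forall => /existsP[k0 hk0].
(* The exit index [i] has the smallest breakpoint among the coordinates negative at the endpoint. *)
pose K := [pred k | bcoord M J k (y 1) < 0].
have Kk0 : K k0 by rewrite /= ltNge.
have [i Ki mini] := @arg_minP _ R _ k0 K (fun k => breakpoint (J, k)) Kk0.
have {}mini k : bcoord M J k (y 1) < 0 -> breakpoint (J, i) <= breakpoint (J, k).
  exact: mini.
have {}Ki : bcoord M J i (y 1) < 0 by [].
(* A coordinate that ends negative cannot vanish at [t], for it would then increase. *)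
have slope k : bcoord M J k (y 1) < 0 -> 0 < bcoord M J k (y t) /\ bcoord M J k U < 0.
  have [ge0 eq0] := st k; move: eq0 ge0; rewrite !bcoord_line => eq0 ge0 h1.
  have pos : 0 < bcoord M J k y0 + t * bcoord M J k U.
    rewrite lt_neqAle ge0 andbT eq_sym; apply/eqP => e; have := eq0 e; nra.
  split=> //; nra.
have bpE k : bcoord M J k (y 1) < 0 ->
    bcoord M J k y0 = - breakpoint (J, k) * bcoord M J k U.
  by move=> /slope[_ U0]; rewrite /breakpoint /=; field; rewrite lt_eqF.
have [yit Ui] := slope i Ki.
set t' := breakpoint (J, i) in mini.
have Ei := bpE i Ki; rewrite -/t' in Ei.
have tt' : t < t' by move: yit; rewrite bcoord_line Ei; nra.
have t'1 : t' < 1 by move: Ki; rewrite bcoord_line Ei; nra.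
have yi : bcoord M J i (y t') = 0 by rewrite bcoord_line Ei; ring.
have [nz ties] := gen uJ yi.
have yk k : k != i -> 0 < bcoord M J k (y t').
  move=> ki; rewrite lt_neqAle eq_sym nz //=.
  have [h|h] := lerP 0 (bcoord M J k (y 1)).
    have [ge0 _] := st k; move: h ge0; rewrite !bcoord_line => h ge0.
    (* The point at [t'] is a convex combination of those at [t] and 1. *)
    have e : (1 - t) * (bcoord M J k y0 + t' * bcoord M J k U) =
        (1 - t') * (bcoord M J k y0 + t * bcoord M J k U)
        + (t' - t) * (bcoord M J k y0 + 1 * bcoord M J k U) by ring.
    rewrite -(@pmulr_rge0 _ (1 - t)) ?subr_gt0 // e.
    by rewrite addr_ge0 // mulr_ge0 // subr_ge0 ltW.
  have [_ Uk] := slope k h; rewrite bcoord_line (bpE k h).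
  have := mini k h; nra.
have [J' [i' [adj yk']]] := pivot_step sM uJ yi yk (exit_pivot_pos uJ uJ2 (fun k => ltW (endJ2 k)) Ki) ties.
have [_ uJ' _ [g [g0 gE]]] := adj.
apply: (@linkedS _ _ _ J J') => //.
  by exists i, i', t'; split.
apply: (IH J' t') => //; last 1 first.
(* Coordinate [i'] vanishes at [t'] and, by the factor [- g], increases along [U]. *)
- move=> k; have [->|ki'] := eqVneq k i'.
    by rewrite !gE yi mulr0; split=> // _; rewrite mulNr oppr_gt0 pmulr_rlt0.
  by have h := yk' k ki'; split; [exact: ltW | move=> e; rewrite e ltxx in h].
- apply: leq_trans Hm; apply: proper_card; apply/properP; split.
    by apply/subsetP => s; rewrite !inE; apply: lt_trans.
  by exists (J, i); rewrite !inE -/t' ?ltxx.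
- by apply: le_trans t0 (ltW tt').
Qed.

End Walk.

(** * Dimensions of cones cut by an affine subspace *)

Section AffineDimension.
Variable R : rcfType.

Lemma aff_indep_pts_sub n (X Y : cset R n) m :
  (forall x, X x -> Y x) -> aff_indep_pts X m -> aff_indep_pts Y m.
Proof.
by move=> XY [x0 [Xx0 [D [hD rD]]]]; exists x0; split; auto; exists D; split; auto.
Qed.

Lemma aff_indep_pts_factor n d (Q : 'M[R]_(n, d)) (q : 'cV[R]_n) (X : cset R n) m :
  (forall x, X x -> Sset Q q x) -> aff_indep_pts X m ->
  exists th (T : 'M[R]_(d, m)),
    [/\ X (q + Q *m th), forall j, X (q + Q *m th + Q *m col j T) & \rank (Q *m T) = m].
Proof.
move=> XQ [x0 [Xx0 [D [hD rD]]]].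
have [th E] := XQ _ Xx0; subst x0.
have : (D^T <= Q^T)%MS.
  apply/row_subP => j; have [th' E'] := XQ _ (hD j).
  apply/submxP; exists (th' - th)^T.
  rewrite -trmx_mul -tr_col; congr trmx.
  rewrite mulmxBr -[col j D](addKr (q + Q *m th)) E' opprD.
  by apply/colP => k; rewrite !mxE; ring.
case/submxP => T /(congr1 trmx); rewrite trmx_mul !trmxK => ED.
exists th, T^T; split=> // [j|]; last by rewrite -ED.
by have := hD j; rewrite ED !colE mulmxA.
Qed.

Lemma aff_indep_pts_rank n d (Q : 'M[R]_(n, d)) (q : 'cV[R]_n) (X : cset R n) m :
  (forall x, X x -> Sset Q q x) -> aff_indep_pts X m -> (m <= d)%N.
Proof.
move=> XQ /(aff_indep_pts_factor XQ)[th [T [_ _ <-]]].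
by apply: leq_trans (mxrankM_maxl _ _) (rank_leq_col _).
Qed.

(** In parameter space the difference vectors lie in the kernel of the nonzero row [c *m Q], of
    dimension d - 1. *)
Lemma aff_indep_pts_hyperplane n d (Q : 'M[R]_(n, d)) (q : 'cV[R]_n) (X : cset R n)
    m (c : 'rV[R]_n) :
  (forall x, X x -> Sset Q q x) -> (forall x, X x -> c *m x = 0) -> c *m Q != 0 ->
  aff_indep_pts X m -> (m < d)%N.
Proof.
move=> XQ Xc cQ /(aff_indep_pts_factor XQ)[th [T [X0 XT rT]]].
have cQT : (c *m Q) *m T = 0.
  apply/rowP => j; have := Xc _ (XT j).
  rewrite mulmxDr (Xc _ X0) add0r !mulmxA => /(congr1 (fun A : 'M_1 => A 0 0)).
  by rewrite colE mulmxA -colE [LHS]mxE !mxE.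
have mT : (m <= \rank T)%N by rewrite -[X in (X <= _)%N]rT mxrankM_maxr.
by have := mulmx0_rank_max cQT; rewrite rank_rV cQ; apply: leq_trans.
Qed.

Lemma affdim_nat n (X : cset R n) m :
  affdim X m%:Z <-> aff_indep_pts X m /\ ~ aff_indep_pts X m.+1.
Proof.
split=> [[[]//|[m' [[<-]]]]//|h].
by right; exists m.
Qed.

Lemma row_kernel_basis d (c : 'rV[R]_d.+1) : c != 0 ->
  exists K : 'M[R]_(d.+1, d), c *m K = 0 /\ \rank K = d.
Proof.
move=> c0; have rk : \rank (kermx c^T) = d.
  by rewrite mxrank_ker mxrank_tr rank_rV c0 subn1.
have : exists B : 'M_(\rank (kermx c^T), d.+1), B *m c^T = 0 /\ \rank B = \rank (kermx c^T).
  exists (row_base (kermx c^T)); split; last by rewrite eq_row_base.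
  by apply/sub_kermxP; rewrite eq_row_base.
rewrite rk => -[B [Bc rB]]; exists B^T; split; last by rewrite mxrank_tr.
by apply: trmx_inj; rewrite trmx_mul trmxK Bc trmx0.
Qed.

End AffineDimension.

Section Domains.
Variables (R : rcfType) (n d : nat) (M : 'M[R]_n) (Q : 'M[R]_(n, d)) (q : 'cV[R]_n).
Hypothesis rQ : \rank Q = d.
Implicit Types J : {set 'I_n}.

Lemma ccone_bcoordP J x : basis_mx M J \in unitmx ->
  ccone M (basis_set J) x <-> forall k, 0 <= bcoord M J k x.
Proof. exact: ccone_unit. Qed.

Lemma Seps_Sset e x : Seps Q q e x <-> Sset Q (q + epsvec n e) x.
Proof.
split=> [[y [[th ->] ->]]|[th ->]]; first by exists th; rewrite addrAC.
by exists (q + Q *m th); split; [exists th | rewrite addrAC].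
Qed.

Lemma ev_bcoord_gt0 J k (p v : 'cV[R]_n) : 0 < bcoord M J k p ->
  ev (fun h => 0 < bcoord M J k (p + h *: v)).
Proof.
move=> /(ev_affine_gt0 (bcoord M J k v)); apply: ev_mono => h _.
by rewrite bcoordD bcoordZ.
Qed.

Lemma affdim_interior J e p : basis_mx M J \in unitmx -> Seps Q q e p ->
  (forall k, 0 < bcoord M J k p) ->
  affdim (csetI (ccone M (basis_set J)) (Seps Q q e)) d%:Z.
Proof.
move=> uJ /Seps_Sset Sp pos; apply/affdim_nat; split.
  have /ev_witness[h [h0 hh]] :
    ev (fun h => forall kj : 'I_n * 'I_d, 0 < bcoord M J kj.1 (p + h *: col kj.2 Q)).
    by apply: ev_all => -[k j]; apply: ev_bcoord_gt0.
  exists p; split.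
    by split; [apply/(ccone_bcoordP p uJ) => k; exact: ltW | exact/Seps_Sset].
  exists (h *: Q); split; last by rewrite mxrank_scale_nz ?gt_eqF.
  move=> j; have -> : col j (h *: Q) = h *: col j Q by rewrite linearZ.
  split; first by apply/(ccone_bcoordP _ uJ) => k; exact: ltW (hh (k, j)).
  apply/Seps_Sset; case: Sp => th ->; rewrite colE scalemxAr.
  by eexists; rewrite -addrA -mulmxDr.
move/(@aff_indep_pts_rank _ _ _ Q (q + epsvec n e)) => H.
suff : (d.+1 <= d)%N by rewrite ltnn.
by apply: H => x [_ /Seps_Sset].
Qed.

End Domains.

Section Facets.
Variables (R : rcfType) (n d : nat) (M : 'M[R]_n) (Q : 'M[R]_(n, d.+1)) (q : 'cV[R]_n).
Hypothesis rQ : \rank Q = d.+1.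
Implicit Types J : {set 'I_n}.

(** Lower bound: small steps from [p] along the directions of S that fix coordinate [i]. Upper
    bound: on both cones coordinates [i] and [i'] are nonnegative with ratio [- g], so both vanish,
    and this hyperplane is transverse to S. *)
Lemma affdim_facet J J' i i' e p : adjacent M J J' i i' -> Seps Q q e p ->
  facet_point M J J' i i' p -> row i (invmx (basis_mx M J)) *m Q != 0 ->
  affdim (csetI (csetI (ccone M (basis_set J)) (ccone M (basis_set J'))) (Seps Q q e)) d%:Z.
Proof.
move=> [uJ uJ' _ [g [g0 gE]]] /Seps_Sset Sp [pi pk pk'].
set c := row i _ => cQ.
have cE x : bcoord M J i x = (c *m x) 0 0 by rewrite /c -row_mul mxE.
have pi' : bcoord M J' i' p = 0 by rewrite gE pi mulr0.
apply/affdim_nat; split.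
  have [K [cK rK]] := row_kernel_basis cQ.
  have DK j : bcoord M J i (col j (Q *m K)) = 0.
    by rewrite cE colE !mulmxA cK mul0mx mxE.
  have DK' j : bcoord M J' i' (col j (Q *m K)) = 0 by rewrite gE DK mulr0.
  have /ev_witness[h [h0 hh]] :
    ev (fun h => forall kj : 'I_n * 'I_d,
      (kj.1 != i -> 0 < bcoord M J kj.1 (p + h *: col kj.2 (Q *m K))) /\
      (kj.1 != i' -> 0 < bcoord M J' kj.1 (p + h *: col kj.2 (Q *m K)))).
    apply: ev_all => -[k j] /=; apply: ev_and.
      have [_|ki] := eqVneq k i; first by apply: ev_true.
      by apply: ev_mono (ev_bcoord_gt0 _ (pk _ ki)) => h _ H _; exact: H.
    have [_|ki] := eqVneq k i'; first by apply: ev_true.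
    by apply: ev_mono (ev_bcoord_gt0 _ (pk' _ ki)) => h _ H _; exact: H.
  exists p; split.
    split; last exact/Seps_Sset.
    split; apply/ccone_bcoordP => // k.
      by have [->|/pk /ltW//] := eqVneq k i; rewrite pi.
    by have [->|/pk' /ltW//] := eqVneq k i'; rewrite pi'.
  exists (h *: (Q *m K)); split; last first.
    rewrite mxrank_scale_nz ?gt_eqF // -mxrank_tr trmx_mul mxrankMfree ?mxrank_tr //.
    by rewrite /row_free mxrank_tr rQ.
  move=> j; have -> : col j (h *: (Q *m K)) = h *: col j (Q *m K) by rewrite linearZ.
  split.
    split; apply/ccone_bcoordP => // k; have /= [H H'] := hh (k, j).
      by have [->|/H /ltW//] := eqVneq k i; rewrite bcoordD bcoordZ pi DK mulr0 addr0.
    by have [->|/H' /ltW//] := eqVneq k i'; rewrite bcoordD bcoordZ pi' DK' mulr0 addr0.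
  apply/Seps_Sset; case: Sp => th ->; rewrite colE -mulmxA scalemxAr.
  by eexists; rewrite -addrA -mulmxDr.
move/(@aff_indep_pts_hyperplane _ _ _ Q (q + epsvec n e) _ _ c) => H.
suff : (d.+1 < d.+1)%N by rewrite ltnn.
apply: H => // [x [_ /Seps_Sset//]|x [[/(ccone_bcoordP _ uJ)/(_ i) h1 /(ccone_bcoordP _ uJ')/(_ i') h2] _]].
move: h2; rewrite gE mulNr oppr_ge0 pmulr_rle0 // => h2.
rewrite [c *m x]mx11_scalar -cE; have -> : bcoord M J i x = 0 by apply/eqP; rewrite eq_le h1 h2.
by rewrite raddf0.
Qed.

(** Along [v] coordinate [i] decreases and, by the factor [- g], [i'] increases; the others stay
    positive for small steps. For [v] a direction of S, the two points witness full dimension of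
    both slices. *)
Lemma facet_point_interior J J' i i' p v : adjacent M J J' i i' ->
  facet_point M J J' i i' p -> bcoord M J i v < 0 ->
  exists h, (forall k, 0 < bcoord M J k (p - h *: v)) /\
            (forall k, 0 < bcoord M J' k (p + h *: v)).
Proof.
move=> [_ _ _ [g [g0 gE]]] [pi pk pk'] vi.
have /ev_witness[h [h0 hh]] : ev (fun h => forall k,
    (k != i -> 0 < bcoord M J k (p + h *: - v)) /\
    (k != i' -> 0 < bcoord M J' k (p + h *: v))).
  apply: ev_all => k; apply: ev_and.
    have [_|ki] := eqVneq k i; first by apply: ev_true.
    by apply: ev_mono (ev_bcoord_gt0 _ (pk _ ki)) => h _ H _; exact: H.
  have [_|ki] := eqVneq k i'; first by apply: ev_true.
  by apply: ev_mono (ev_bcoord_gt0 _ (pk' _ ki)) => h _ H _; exact: H.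
exists h; split=> k; have [H H'] := hh k.
  have [->|/H] := eqVneq k i; last by rewrite scalerN.
  by rewrite -scaleNr bcoordD bcoordZ pi add0r nmulr_rgt0 // oppr_lt0.
have [->|/H'//] := eqVneq k i'.
by rewrite bcoordD bcoordZ !gE pi mulr0 add0r pmulr_rgt0 // nmulr_rgt0 // oppr_lt0.
Qed.

End Facets.

(** * Genericity *)

Section Genericity.
Variables (R : rcfType) (n : nat) (M : 'M[R]_n).
Implicit Types J : {set 'I_n}.

Lemma ev_dichotomy (T : finType) (P : T -> R -> Prop) :
  (forall x, ev (P x) \/ ev (fun e => ~ P x e)) ->
  ev (fun e => forall x, P x e) \/ ev (fun e => ~ forall x, P x e).
Proof.
move=> h.
have : (forall x, x \in enum T -> ev (P x)) \/ exists x, ev (fun e => ~ P x e).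
  elim: (enum T) => [|x s [IH|]]; [by left| |by right].
  have [hx|hx] := h x; [left|by right; exists x].
  by move=> y; rewrite inE => /predU1P[->|/IH].
case=> [all_ev|[x hx]]; [left|right].
  by apply: ev_all => x; apply: all_ev; rewrite mem_enum.
by apply: ev_mono hx => e _ nP /(_ x).
Qed.

Lemma ev_form_neq0 (c : 'rV[R]_n) (P : 'cV[R]_n) : c != 0 ->
  ev (fun e => (c *m (P + epsvec n e)) 0 0 != 0).
Proof.
move=> c0; have := @ev_epsvec_neq0 R n c ((c *m P) 0 0); rewrite c0 orbT => /(_ isT).
by apply: ev_mono => e _; rewrite mulmxDr [(_ + _ : 'M_(1, 1)) 0 0]mxE.
Qed.

Lemma ev_form_dichotomy (c : 'rV[R]_n) (P : 'cV[R]_n) :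
  ev (fun e => 0 < (c *m (P + epsvec n e)) 0 0) \/
  ev (fun e => ~ 0 < (c *m (P + epsvec n e)) 0 0).
Proof.
have E e : (c *m (P + epsvec n e)) 0 0 = (c *m P) 0 0 + (c *m epsvec n e) 0 0.
  by rewrite mulmxDr mxE.
have [c0|c0] := eqVneq c 0.
  by right; apply: ev_true => e; rewrite c0 mul0mx mxE ltxx.
have [] := @ev_epsvec_sign R n c ((c *m P) 0 0); first by rewrite c0 orbT.
  by move=> h; left; apply: ev_mono h => e _; rewrite E.
by move=> h; right; apply: ev_mono h => e _; rewrite E => h /(lt_trans h); rewrite ltxx.
Qed.

(* Some nontrivial combination of the two forms is constant along U, and it is nonzero for
   small e. *)
Lemma ev_independent_forms (c c' : 'rV[R]_n) (P U : 'cV[R]_n) :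
  (forall a b, a *: c + b *: c' = 0 -> a = 0 /\ b = 0) ->
  ev (fun e => forall t, (c *m (P + epsvec n e + t *: U)) 0 0 = 0 ->
     (c' *m (P + epsvec n e + t *: U)) 0 0 != 0).
Proof.
move=> ind.
have E (r : 'rV[R]_n) (x : 'cV[R]_n) t :
    (r *m (x + t *: U)) 0 0 = (r *m x) 0 0 + t * (r *m U) 0 0.
  by rewrite mulmxDr -scalemxAr !mxE.
have [cU0|cU] := boolP (((c *m U) 0 0 == 0) && ((c' *m U) 0 0 == 0)).
  have c0 : c != 0.
    apply/eqP => c0; have := ind 1 0; rewrite c0 scaler0 scale0r addr0 => /(_ erefl)[].
    by move/eqP; rewrite oner_eq0.
  apply: ev_mono (ev_form_neq0 P c0) => e _ h t.
  by rewrite E; case/andP: cU0 => /eqP-> _; rewrite mulr0 addr0 => e0; rewrite e0 eqxx in h.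
(* The coefficients make [r *m U] vanish. *)
pose r := (c' *m U) 0 0 *: c + - (c *m U) 0 0 *: c'.
have r0 : r != 0.
  apply: contraNneq cU => /ind[-> /eqP]; rewrite oppr_eq0 => /eqP->.
  by rewrite eqxx.
apply: ev_mono (ev_form_neq0 P r0) => e _ h t h1; apply: contra_neq h => h2.
rewrite /r mulmxDl -!scalemxAl [LHS]mxE ![(_ *: _ : 'M_(1, 1)) _ _]mxE.
move: h1 h2; rewrite !E => h1 h2.
rewrite (_ : (c *m (P + epsvec n e)) 0 0 = - (t * (c *m U) 0 0)); last by lra.
rewrite (_ : (c' *m (P + epsvec n e)) 0 0 = - (t * (c' *m U) 0 0)); last by lra.
by ring.
Qed.

Lemma bcoord_form J k x : bcoord M J k x = (row k (invmx (basis_mx M J)) *m x) 0 0.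
Proof. by rewrite -row_mul mxE. Qed.

(** A nonzero combination of basis coordinates that omits coordinate [i] is linearly independent of
    it. *)
Lemma ev_coord_form J i (v : 'rV[R]_n) (P U : 'cV[R]_n) :
  basis_mx M J \in unitmx -> v 0 i = 0 -> v != 0 ->
  ev (fun e => forall t, bcoord M J i (P + epsvec n e + t *: U) = 0 ->
     (v *m (invmx (basis_mx M J) *m (P + epsvec n e + t *: U))) 0 0 != 0).
Proof.
move=> uJ vi v0.
have := @ev_independent_forms (row i (invmx (basis_mx M J)))
  (v *m invmx (basis_mx M J)) P U.
move=> H; apply: ev_mono (H _) => [e _ h t|a b].
  by rewrite bcoord_form mulmxA; exact: h.
rewrite rowE !scalemxAl -mulmxDl => /(congr1 (mulmx^~ (basis_mx M J))).
rewrite mulmxKV // mul0mx => /rowP E.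
have a0 : a = 0 by have := E i; rewrite !mxE vi !eqxx mulr1 mulr0 addr0.
split=> //; apply/eqP; apply: contraNT v0 => b0; apply/eqP/rowP => k.
have := E k; rewrite a0 !mxE mul0r add0r => /eqP.
by rewrite mulf_eq0 (negbTE b0) => /eqP.
Qed.

Lemma ev_generic_line (P U : 'cV[R]_n) :
  ev (fun e => generic_line M (P + epsvec n e) U).
Proof.
have mulE J (a b : R) k l (x : 'cV[R]_n) :
    ((a *: delta_mx 0 k + b *: delta_mx 0 l : 'rV_n) *m (invmx (basis_mx M J) *m x)) 0 0
    = a * bcoord M J k x + b * bcoord M J l x.
  by rewrite mulmxDl -!scalemxAl -!rowE [LHS]mxE ![(_ *: row _ _) _ _]mxE ![row _ _ _ _]mxE.
have vE (a b : R) k l (m : 'I_n) :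
    (a *: delta_mx 0 k + b *: delta_mx 0 l : 'rV_n) 0 m =
    a * (m == k)%:R + b * (m == l)%:R.
  by rewrite !mxE eqxx.
have H1 : ev (fun e => forall s : {set 'I_n} * 'I_n * 'I_n,
    basis_mx M s.1.1 \in unitmx -> s.2 != s.1.2 ->
    forall t, bcoord M s.1.1 s.1.2 (P + epsvec n e + t *: U) = 0 ->
      bcoord M s.1.1 s.2 (P + epsvec n e + t *: U) != 0).
  apply: ev_all => -[[J i] k] /=.
  have [uJ|uJ] := boolP (basis_mx M J \in unitmx); last by apply: ev_true.
  have [|ki] := eqVneq k i; first by move=> _; apply: ev_true.
  pose v : 'rV[R]_n := 1 *: delta_mx 0 k + 0 *: delta_mx 0 k.
  apply: ev_mono (@ev_coord_form J i v P U uJ _ _).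
  - by move=> e _ h _ _ t /h; rewrite mulE mul1r mul0r addr0.
  - by rewrite vE eq_sym (negbTE ki) !mulr0 addr0.
  apply: contraTneq isT => /rowP/(_ k)/eqP.
  by rewrite vE !mxE eqxx mulr1 mul0r addr0 oner_eq0.
have H2 : ev (fun e => forall s : {set 'I_n} * 'I_n * 'I_n * 'I_n,
    let J := s.1.1.1 in let i := s.1.1.2 in let k := s.1.2 in let l := s.2 in
    basis_mx M J \in unitmx -> k != l -> k != i -> l != i ->
    pivot_mx M J k i < 0 -> pivot_mx M J l i < 0 ->
    forall t, bcoord M J i (P + epsvec n e + t *: U) = 0 ->
    pivot_mx M J l i * bcoord M J k (P + epsvec n e + t *: U)
    - pivot_mx M J k i * bcoord M J l (P + epsvec n e + t *: U) != 0).
  apply: ev_all => -[[[J i] k] l] /=.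
  have [uJ|uJ] := boolP (basis_mx M J \in unitmx); last by apply: ev_true.
  have [|kl] := eqVneq k l; first by move=> _; apply: ev_true.
  have [|ki] := eqVneq k i; first by move=> _; apply: ev_true.
  have [|li] := eqVneq l i; first by move=> _; apply: ev_true.
  have [Nk|Nk] := boolP (pivot_mx M J k i < 0); last by apply: ev_true.
  (* This form vanishes exactly at a tie of the ratio test; it is nonzero because
     [pivot_mx M J k i < 0]. *)
  pose v : 'rV[R]_n := pivot_mx M J l i *: delta_mx 0 k + - pivot_mx M J k i *: delta_mx 0 l.
  apply: ev_mono (@ev_coord_form J i v P U uJ _ _).
  - by move=> e _ h _ _ _ _ _ _ t /h; rewrite mulE mulNr.
  - by rewrite vE eq_sym (negbTE ki) eq_sym (negbTE li) !mulr0 addr0.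
  apply: contraTneq Nk => /rowP/(_ l)/eqP.
  rewrite vE [X in _ == X]mxE eqxx (eq_sym l k) (negbTE kl) mulr0 mulr1 add0r oppr_eq0 => /eqP->.
  by rewrite ltxx.
apply: ev_mono (ev_and H1 H2) => e _ [h1 h2] J i t uJ yi; split.
  by move=> k ki; exact: (h1 (J, i, k) uJ ki t yi).
by move=> k l kl ki li Nk Nl; exact: (h2 (J, i, k, l) uJ kl ki li Nk Nl t yi).
Qed.

(* The parameter t of the facet point is determined by the i-th coordinate, so that the
   remaining conditions are signs of polynomials in e. *)
Lemma ev_facet_point_dichotomy J J' i i' (P U : 'cV[R]_n) : bcoord M J i U != 0 ->
  let Phi e := exists t, facet_point M J J' i i' (P + epsvec n e + t *: U) in
  ev Phi \/ ev (fun e => ~ Phi e).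
Proof.
move=> Ui Phi.
pose t e := - bcoord M J i (P + epsvec n e) / bcoord M J i U.
have tE e s : bcoord M J i (P + epsvec n e + s *: U) = 0 -> s = t e.
  rewrite bcoordD bcoordZ => h; apply: (mulIf Ui).
  by rewrite /t divfK //; lra.
(* Eliminating [t] turns each coordinate into a linear form in [P + epsvec n e]. *)
pose c K k := row k (invmx (basis_mx M K))
   - (bcoord M K k U / bcoord M J i U) *: row i (invmx (basis_mx M J)).
have cE K k e : bcoord M K k (P + epsvec n e + t e *: U) =
    (c K k *m (P + epsvec n e)) 0 0.
  rewrite bcoordD bcoordZ /c mulmxBl -scalemxAl [RHS]mxE [(- _ : 'M_(1, 1)) _ _]mxE.
  by rewrite [(_ *: _ : 'M_(1, 1)) _ _]mxE -!bcoord_form /t; field.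
have D : ev (fun e => forall k, (k != i -> 0 < bcoord M J k (P + epsvec n e + t e *: U)) /\
      (k != i' -> 0 < bcoord M J' k (P + epsvec n e + t e *: U))) \/
    ev (fun e => ~ forall k, (k != i -> 0 < bcoord M J k (P + epsvec n e + t e *: U)) /\
      (k != i' -> 0 < bcoord M J' k (P + epsvec n e + t e *: U))).
  apply: ev_dichotomy => k.
  have side K (j : 'I_n) : ev (fun e => k != j -> 0 < bcoord M K k (P + epsvec n e + t e *: U))
    \/ ev (fun e => ~ (k != j -> 0 < bcoord M K k (P + epsvec n e + t e *: U))).
    have [_|kj] := eqVneq k j; first by left; apply: ev_true.
    have [h|h] := ev_form_dichotomy (c K k) P; [left|right]; apply: ev_mono h => e _.
      by rewrite cE.
    by rewrite cE => h /(_ isT).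
  have [h1|h1] := side J i; last by right; apply: ev_mono h1 => e _ h [].
  have [h2|h2] := side J' i'; last by right; apply: ev_mono h2 => e _ h [].
  by left; exact: ev_and.
case: D => h; [left|right]; apply: ev_mono h => e _ h.
  exists (t e); split=> [|k ki|k ki]; try by have [h1 h2] := h k; auto.
  by rewrite bcoordD bcoordZ /t divfK // subrr.
by move=> [s [/tE-> h1 h2]]; apply: h => k; split; auto.
Qed.

(** The weights are powers of [s], so each coordinate of the point is a polynomial in [s]; unless it
    is the zero polynomial, it is nonzero for small [s]. *)
Lemma generic_simplex m (x0 : 'cV[R]_n) (A : 'M[R]_(n, m)) :
  exists s, [/\ 0 < s, \sum_j epsvec m s j 0 < 1 &
    forall J k, bcoord M J k (x0 + A *m epsvec m s) = 0 ->
      bcoord M J k x0 = 0 /\ forall v, bcoord M J k (A *m v) = 0].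
Proof.
have H1 : ev (fun s : R => 0 < 1 + ((const_mx (-1) : 'rV[R]_m) *m epsvec m s) 0 0).
  exact: ev_epsvec_gt0.
have H2 : ev (fun s => forall Jk : {set 'I_n} * 'I_n,
    bcoord M Jk.1 Jk.2 (x0 + A *m epsvec m s) = 0 ->
    bcoord M Jk.1 Jk.2 x0 = 0 /\ forall v, bcoord M Jk.1 Jk.2 (A *m v) = 0).
  apply: ev_all => -[J k] /=.
  have [/andP[/eqP b0 /eqP r0]|] :=
      boolP ((bcoord M J k x0 == 0) && (row k (invmx (basis_mx M J)) *m A == 0)).
    apply: ev_true => s _; split=> // v.
    by rewrite bcoord_form mulmxA r0 mul0mx mxE.
  rewrite negb_and => /ev_epsvec_neq0; apply: ev_mono => s _.
  by rewrite bcoordD [X in _ + X = 0]bcoord_form mulmxA => h e; rewrite e eqxx in h.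
have /ev_witness[s [s0 [h1 h2]]] := ev_and H1 H2.
exists s; split=> // [|J k]; last exact: (h2 (J, k)).
move: h1; rewrite mxE; under eq_bigr do rewrite mxE mulN1r.
by rewrite sumrN subr_gt0.
Qed.

Lemma bcoord_mulmx J k m (A : 'M[R]_(n, m)) (v : 'cV[R]_m) :
  bcoord M J k (A *m v) = \sum_j v j 0 * bcoord M J k (col j A).
Proof.
rewrite bcoord_form mulmxA mxE; apply: eq_bigr => j _; rewrite mulrC bcoord_form.
by rewrite colE mulmxA -colE [in RHS]mxE.
Qed.

Lemma simplex_bcoord_ge0 J k m (x0 : 'cV[R]_n) (A : 'M[R]_(n, m)) (v : 'cV[R]_m) :
  0 <= bcoord M J k x0 -> (forall j, 0 <= bcoord M J k (x0 + col j A)) ->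
  (forall j, 0 <= v j 0) -> \sum_j v j 0 <= 1 -> 0 <= bcoord M J k (x0 + A *m v).
Proof.
move=> b0 bj v0 v1; rewrite bcoordD bcoord_mulmx.
have -> : bcoord M J k x0 + \sum_j v j 0 * bcoord M J k (col j A) =
    (1 - \sum_j v j 0) * bcoord M J k x0 + \sum_j v j 0 * bcoord M J k (x0 + col j A).
  rewrite mulrBl mul1r -addrA; congr (_ + _); rewrite mulr_suml -sumrN -big_split.
  by apply: eq_bigr => j _; rewrite /= bcoordD; ring.
rewrite addr_ge0 ?mulr_ge0 ?subr_ge0 // sumr_ge0 // => j _.
by rewrite mulr_ge0.
Qed.

End Genericity.

(** * Interior points of critical domains and generic points of a common face *)

Section CriticalDomains.
Variables (R : rcfType) (n d : nat) (M : 'M[R]_n) (Q : 'M[R]_(n, d)) (q : 'cV[R]_n).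
Implicit Types J : {set 'I_n}.

Lemma critdom_bcoord J th : basis_mx M J \in unitmx ->
  critdom M Q q (basis_set J) (q + Q *m th) <-> forall k, 0 <= bcoord M J k (q + Q *m th).
Proof.
move=> uJ; split=> [[/(ccone_bcoordP _ uJ)//]|h].
by split; [exact/ccone_bcoordP | exists th].
Qed.

(** The second alternative covers S contained in the hyperplane of a facet, where the perturbation
    decides the side. *)
Definition robustly_interior J (th : 'cV[R]_d) : Prop :=
  forall k, 0 < bcoord M J k (q + Q *m th) \/
    (forall th', bcoord M J k (q + Q *m th') = 0) /\
    ev (fun e => 0 < bcoord M J k (epsvec n e)).

(** A coordinate that is 0 at a generic point of a full-dimensional simplex vanishes on all of S. On
    the perturbed S it is constant; for small [e] it is nonnegative, as the cone meets that set, and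
    nonzero as a nontrivial form in [epsvec n e]. *)
Lemma inV_robustly_interior J : \rank Q = d -> basis_mx M J \in unitmx ->
  inV M Q q (basis_set J) -> exists th, robustly_interior J th.
Proof.
move=> rQ uJ [[_ evJ] /affdim_nat[indep _]].
have [|th [T [X0 XT rT]]] := @aff_indep_pts_factor _ _ _ Q q _ _ _ indep; first by move=> x [].
have uT : T \in unitmx.
  rewrite -row_full_unit /row_full eqn_leq rank_leq_col.
  by rewrite -[X in (X <= _)%N]rT mxrankM_maxr.
have [s [s0 s1 gen]] := generic_simplex M (q + Q *m th) (Q *m T).
exists (th + T *m epsvec d s) => k; rewrite mulmxDr addrA mulmxA.
have ge0 : 0 <= bcoord M J k (q + Q *m th + Q *m T *m epsvec d s).
  apply: simplex_bcoord_ge0 (ltW s1).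
  - by move: X0 => /(critdom_bcoord _ uJ).
  - move=> j; have := XT j; rewrite -addrA -mulmxDr => /(critdom_bcoord _ uJ)/(_ k).
    by rewrite mulmxDr addrA !colE mulmxA.
  - by move=> j; rewrite mxE exprn_ge0 ?ltW.
rewrite lt_neqAle ge0 andbT; have [e|_] := eqVneq 0 _; last by left.
right; have [b0 bv] := gen J k (esym e).
have all0 th' : bcoord M J k (q + Q *m th') = 0.
  have -> : q + Q *m th' = q + Q *m th + Q *m T *m (invmx T *m (th' - th)).
    by rewrite mulmxA mulmxK // mulmxBr; apply/colP => i; rewrite !mxE; ring.
  by rewrite bcoordD b0 bv addr0.
split=> //.
have c0 : row k (invmx (basis_mx M J)) != 0.
  apply: contraTneq isT => /(congr1 (mulmx^~ (basis_mx M J))).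
  rewrite -row_mul mulVmx // mul0mx => /rowP/(_ k)/eqP.
  by rewrite !mxE eqxx oner_eq0.
apply: ev_mono (ev_and evJ (ev_form_neq0 0 c0)) => e' _ [/affdim_nat[[p [[Cp Sp] _]] _]].
rewrite add0r -bcoord_form lt_neqAle eq_sym => -> /=.
case/Seps_Sset: Sp => th' Ep; move: Cp; rewrite Ep addrAC => /(ccone_bcoordP _ uJ)/(_ k).
by rewrite bcoordD all0 add0r.
Qed.

(** Each unperturbed coordinate is a convex combination with positive weight on [th1], so it is
    positive, or zero throughout S and then made positive by the perturbation. *)
Lemma ev_robustly_interior J (th th1 : 'cV[R]_d) (eta : R) :
  robustly_interior J th1 -> (forall k, 0 <= bcoord M J k (q + Q *m th)) ->
  0 < eta -> eta < 1 ->
  ev (fun e => forall k, 0 < bcoord M J k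
       (q + Q *m th + eta *: (Q *m (th1 - th)) + epsvec n e)).
Proof.
move=> h1 h0 eta0 eta1; apply: ev_all => k.
have E : bcoord M J k (q + Q *m th + eta *: (Q *m (th1 - th))) =
    (1 - eta) * bcoord M J k (q + Q *m th) + eta * bcoord M J k (q + Q *m th1).
  rewrite -!bcoordZ -bcoordD; congr bcoord; rewrite mulmxBr.
  by apply/colP => i; rewrite !mxE; ring.
have [pos|[z pos]] := h1 k.
  have b0 : 0 < bcoord M J k (q + Q *m th + eta *: (Q *m (th1 - th))).
    by rewrite E ltr_wpDl ?mulr_gt0 // mulr_ge0 // subr_ge0 ltW.
  apply: ev_mono (ev_epsvec_gt0 (row k (invmx (basis_mx M J))) b0) => e _.
  by rewrite -bcoord_form -bcoordD.
apply: ev_mono pos => e _; rewrite bcoordD E !z; lra.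
Qed.

(* The point avoids every hyperplane bounding a cone, except for those that contain the
   whole face. *)
Lemma generic_face_point J1 J2 m : basis_mx M J1 \in unitmx -> basis_mx M J2 \in unitmx ->
  let F := csetI (critdom M Q q (basis_set J1)) (critdom M Q q (basis_set J2)) in
  aff_indep_pts F m ->
  exists th, F (q + Q *m th) /\
    forall J, basis_mx M J \in unitmx -> (forall k, 0 <= bcoord M J k (q + Q *m th)) ->
      aff_indep_pts (csetI (critdom M Q q (basis_set J)) F) m.
Proof.
move=> u1 u2 F indep.
have [|th [T [[X1 X2] XT rT]]] := @aff_indep_pts_factor _ _ _ Q q F _ _ indep.
  by move=> x [[]].
have [s [s0 s1 gen]] := generic_simplex M (q + Q *m th) (Q *m T).
have sE mu : q + Q *m (th + T *m mu) = q + Q *m th + Q *m T *m mu.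
  by rewrite mulmxDr addrA mulmxA.
have convF (mu : 'cV[R]_m) : (forall j, 0 <= mu j 0) -> \sum_j mu j 0 <= 1 -> F (q + Q *m (th + T *m mu)).
  move=> mu0 mu1; split; apply/critdom_bcoord => // k; rewrite sE.
    apply: simplex_bcoord_ge0 => // [|j]; first by move: X1 => /(critdom_bcoord _ u1).
    have [] := XT j; rewrite -addrA -mulmxDr => /(critdom_bcoord _ u1)/(_ k) + _.
    by rewrite mulmxDr addrA !colE mulmxA.
  apply: simplex_bcoord_ge0 => // [|j]; first by move: X2 => /(critdom_bcoord _ u2).
  have [] := XT j; rewrite -addrA -mulmxDr => _ /(critdom_bcoord _ u2)/(_ k).
  by rewrite mulmxDr addrA !colE mulmxA.
have eps0 j : 0 <= epsvec m s j 0 by rewrite mxE exprn_ge0 // ltW.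
exists (th + T *m epsvec m s); split; first by apply: convF => //; exact: ltW.
move=> J uJ Jx.
(* Coordinates of [J] that vanish at the point vanish along all edges of the simplex, and the others
   are positive, so small steps along edges stay in the cone of [J]. *)
have H1 : ev (fun h => forall kj : 'I_n * 'I_m, 0 <= bcoord M J kj.1
    (q + Q *m (th + T *m epsvec m s) + h *: (Q *m T *m delta_mx kj.2 0))).
  apply: ev_all => -[k j] /=; have := Jx k; rewrite le_eqVlt => /predU1P[e|pos].
    apply: ev_true => h; rewrite bcoordD -e add0r bcoordZ.
    by have [_ ->] := gen J k (esym (etrans e (congr1 (bcoord M J k) (sE _)))); rewrite mulr0.
  by apply: ev_mono (ev_bcoord_gt0 (Q *m T *m delta_mx j 0) pos) => h _ H; exact: ltW H.
(* The weights must still sum to at most 1 for the moved point to stay in the simplex, hence in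
   [F]. *)
have H2 : ev (fun h => 0 < (1 - \sum_j epsvec m s j 0) + h * (-1)).
  by apply: ev_affine_gt0; rewrite subr_gt0.
have /ev_witness[h [h0 [h1 h2]]] := ev_and H1 H2.
exists (q + Q *m (th + T *m epsvec m s)); split.
  by split; [exact/critdom_bcoord | apply: convF => //; exact: ltW].
exists (h *: (Q *m T)); split; last by rewrite mxrank_scale_nz ?gt_eqF.
move=> j; have -> : q + Q *m (th + T *m epsvec m s) + col j (h *: (Q *m T)) =
    q + Q *m (th + T *m (epsvec m s + h *: delta_mx j 0)).
  by rewrite !sE mulmxDr addrA colE -scalemxAl scalemxAr.
split.
  apply/critdom_bcoord => // k; have := h1 (k, j).
  by rewrite !sE mulmxDr addrA scalemxAr.
have hE i : (h *: delta_mx j 0 : 'cV[R]_m) i 0 = h * (i == j)%:R by rewrite scale_deltaE.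
apply: convF => [i|]; first by rewrite mxE hE addr_ge0 // mulr_ge0 ?ler0n // ltW.
under eq_bigr do rewrite mxE hE.
have S : \sum_i h * (i == j)%:R = h.
  by rewrite -mulr_sumr (bigD1 j) //= eqxx big1 => [|i /negbTE->//]; rewrite addr0 mulr1.
rewrite big_split /= S; lra.
Qed.

End CriticalDomains.

(** * Choice of the segment and assembly of the path *)

Lemma segment_lt0 (R : rcfType) (a b t : R) :
  0 <= t -> t <= 1 -> a < 0 -> a + b < 0 -> a + t * b < 0.
Proof. by move=> t0 t1 a0 ab; have [b0|b0] := lerP b 0; nra. Qed.

Theorem mainTheorem14 (R : rcfType) (n d : nat)
  (M : 'M[R]_n) (Q : 'M[R]_(n, d)) (q : 'cV[R]_n)
  (B1 B2 : {set 'I_(n + n)}) :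
  sufficient M ->
  \rank Q = d ->
  inV M Q q B1 -> inV M Q q B2 -> B1 != B2 ->
  affdim (csetI (critdom M Q q B1) (critdom M Q q B2)) (d%:Z - 1) ->
  exists (r : nat) (Bt : nat -> {set 'I_(n + n)}),
    (0 < r)%N /\ Bt 0%N = B1 /\ Bt r.-1 = B2 /\
    (forall k, (k < r)%N ->
       inVeps M Q q (Bt k) /\
       affdim (csetI (critdom M Q q (Bt k))
                     (csetI (critdom M Q q B1) (critdom M Q q B2))) (d%:Z - 1)) /\
    (forall k, (k.+1 < r)%N -> inEeps M Q q (Bt k) (Bt k.+1)).
Proof.
move=> sM rQ V1 V2 _.
have [J1 [E1 u1]] := compl_basis_witness V1.1.1.
have [J2 [E2 u2]] := compl_basis_witness V2.1.1; subst B1 B2.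
case: d Q rQ V1 V2 => [|d] Q rQ V1 V2.
  (* For d = 0 the intersection would be empty, while S is a single point lying in both domains. *)
  case=> [[_ []]|[m [/eqP]]]; last by rewrite sub0r; case: m.
  have /affdim_nat[[x [[Cx [th Ex]] _]] _] := V1.2.
  have /affdim_nat[[y [[Cy [th' Ey]] _]] _] := V2.2.
  have Exy : x = y by rewrite Ex Ey (flatmx0 th) (flatmx0 th').
  by exists x; split; split=> //; [exists th | rewrite Exy | exists th].
have -> : d.+1%:Z - 1 = d%:Z by rewrite -addn1 PoszD addrK.
set F := csetI _ _ => /affdim_nat[Find Fub].
have [th [[F1 F2] Fgen]] := generic_face_point u1 u2 Find.
have [th1 int1] := inV_robustly_interior rQ u1 V1.
have [th2 int2] := inV_robustly_interior rQ u2 V2.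
set x := q + Q *m th in F1 F2 Fgen.
have x1 k : 0 <= bcoord M J1 k x by move: F1 => /(critdom_bcoord _ _ _ u1).
have x2 k : 0 <= bcoord M J2 k x by move: F2 => /(critdom_bcoord _ _ _ u2).
pose v1 := Q *m (th1 - th); pose v2 := Q *m (th2 - th).
(* [eta] is so small that a coordinate negative at [x] stays negative at both ends of the
   segment. *)
have /ev_witness[eta [eta0 [eta1 near]]] : ev (fun h : R => h < 1 /\
    forall Jk : {set 'I_n} * 'I_n, bcoord M Jk.1 Jk.2 x < 0 ->
      bcoord M Jk.1 Jk.2 (x + h *: v1) < 0 /\ bcoord M Jk.1 Jk.2 (x + h *: v2) < 0).
  apply: ev_and; first by exists 1.
  apply: ev_all => -[J k] /=; have [xk|_] := ltP (bcoord M J k x) 0; last exact: ev_true.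
  have neg v : ev (fun h => bcoord M J k (x + h *: v) < 0).
    have := @ev_affine_gt0 R (- bcoord M J k x) (- bcoord M J k v).
    rewrite oppr_gt0 => /(_ xk); apply: ev_mono => h _.
    by rewrite bcoordD bcoordZ mulrN -opprD oppr_gt0.
  by apply: ev_mono (ev_and (neg v1) (neg v2)) => h _.
pose P := x + eta *: v1; pose U := eta *: (v2 - v1).
have PU : P + U = x + eta *: v2 by rewrite /P /U scalerBr addrA addrAC addrK.
pose facet J J' i i' e := exists t, facet_point M J J' i i' (P + epsvec n e + t *: U).
have near_e : ev (fun e => forall Jk : {set 'I_n} * 'I_n, bcoord M Jk.1 Jk.2 x < 0 ->
    bcoord M Jk.1 Jk.2 (P + epsvec n e) < 0 /\
    bcoord M Jk.1 Jk.2 (P + U + epsvec n e) < 0).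
  apply: ev_all => -[J k] /=; have [xk|_] := ltP (bcoord M J k x) 0; last exact: ev_true.
  have neg (v : 'cV[R]_n) : bcoord M J k v < 0 ->
      ev (fun e => bcoord M J k (v + epsvec n e) < 0).
    rewrite -oppr_gt0 => /(ev_epsvec_gt0 (- row k (invmx (basis_mx M J)))).
    apply: ev_mono => e _; rewrite mulNmx [(- _ : 'M_(1, 1)) _ _]mxE -bcoord_form -opprD.
    by rewrite oppr_gt0 bcoordD.
  have [n1 n2] := near (J, k) xk.
  rewrite PU; apply: ev_mono (ev_and (neg _ n1) (neg _ n2)) => e _ h _.
  exact: h.
(* Since [facet] is eventually true or eventually false, its truth at one small [e] makes it true at
   all small ones. *)
have stable : ev (fun e => forall s : {set 'I_n} * {set 'I_n} * 'I_n * 'I_n,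
    bcoord M s.1.1.1 s.1.2 U < 0 -> facet s.1.1.1 s.1.1.2 s.1.2 s.2 e ->
    ev (facet s.1.1.1 s.1.1.2 s.1.2 s.2)).
  apply: ev_all => -[[[J J'] i] i'] /=.
  have [Ui|_] := ltP (bcoord M J i U) 0; last exact: ev_true.
  have [|h|h] := @ev_facet_point_dichotomy _ _ M J J' i i' P U; first by rewrite lt_eqF.
    exact: ev_true.
  by apply: ev_mono h => e _ nf _ f; case: nf.
have start := ev_robustly_interior int1 x1 eta0 eta1.
have stop := ev_robustly_interior int2 x2 eta0 eta1.
have /ev_witness[e [e0 [[[gen neare] stab] [starte stope]]]] :=
  ev_and (ev_and (ev_and (ev_generic_line M P U) near_e) stable) (ev_and start stop).
have stop1 k : 0 < bcoord M J2 k (P + epsvec n e + 1 *: U).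
  by rewrite scale1r addrAC PU; exact: stope.
have start0 k : 0 < bcoord M J1 k (P + epsvec n e + 0 *: U).
  by rewrite scale0r addr0; exact: starte.
have SP th' h e' : Seps Q q e' (P + epsvec n e' + h *: U + Q *m th').
  apply/Seps_Sset; exists (th + eta *: (th1 - th) + h *: (eta *: (th2 - th1)) + th').
  rewrite /P /U /x /v1 /v2 -mulmxBr opprB addrA subrK.
  by rewrite !(mulmxDr, =^~ scalemxAr); apply/colP => k; rewrite !mxE; ring.
have walk : linked (meets_segment M (P + epsvec n e) U) (crossing M (P + epsvec n e) U) J1 J2.
  apply: (walk_segment sM gen u2 stop1 (t := 0)) => // k; split; first exact: ltW.
  by move=> e1; have := start0 k; rewrite e1 ltxx.
(* A coordinate negative at [x] would be negative on the whole perturbed segment, which meets the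
   cone. *)
have segment_near J : meets_segment M (P + epsvec n e) U J ->
    basis_mx M J \in unitmx /\ forall k, 0 <= bcoord M J k x.
  move=> [uJ [t [t0 t1 h]]]; split=> // k; rewrite leNgt; apply/negP => xk.
  have /= [] := neare (J, k) xk; have := h k.
  rewrite bcoordD bcoordZ [P + U + _]addrAC [bcoord M J k (_ + U)]bcoordD leNgt.
  by move=> /negP nlt s0 s1; apply: nlt; exact: segment_lt0.
have crossing_edge J J' : crossing M (P + epsvec n e) U J J' ->
    inEeps M Q q (basis_set J) (basis_set J').
  move=> [i [i' [t [adj Ui fp]]]].
  have [uJ uJ' JJ' _] := adj.
  have evf : ev (facet J J' i i') by apply: (stab (J, J', i, i')) => //; exists t.
  (* Coordinate [i] changes along [U], a direction of S. *)
  have cQ : row i (invmx (basis_mx M J)) *m Q != 0.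
    apply: contraTneq Ui => cQ.
    by rewrite /U /v1 /v2 -mulmxBr bcoordZ bcoord_form mulmxA cQ mul0mx mxE mulr0 ltxx.
  have UQ h : h *: U = Q *m (h *: (eta *: (th2 - th1))).
    rewrite /U /v1 /v2 -mulmxBr opprB addrA subrK.
    by rewrite -!scalemxAr.
  have SP0 t' e' : Seps Q q e' (P + epsvec n e' + t' *: U).
    by rewrite -[_ + _ *: U]addr0 -(mulmx0 _ Q).
  split; first by apply: contra_neq JJ' => /basis_set_inj.
  split.
    split; first exact: compl_basis_set.
    apply: ev_mono evf => e' _ [t' fp'].
    have [h [hJ _]] := facet_point_interior adj fp' Ui.
    by apply: affdim_interior hJ => //; rewrite -scaleNr (UQ (- h)).
  split.
    split; first exact: compl_basis_set.
    apply: ev_mono evf => e' _ [t' fp'].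
    have [h [_ hJ]] := facet_point_interior adj fp' Ui.
    by apply: affdim_interior hJ => //; rewrite (UQ h).
  have -> : d.+1%:Z - 1 = d%:Z by rewrite -addn1 PoszD addrK.
  by apply: ev_mono evf => e' _ [t' fp']; apply: (affdim_facet rQ adj (SP0 t' e') fp').
have triple J : meets_segment M (P + epsvec n e) U J ->
    affdim (csetI (critdom M Q q (basis_set J)) F) d%:Z.
  move=> /segment_near[uJ xJ]; apply/affdim_nat; split; first exact: Fgen.
  by move=> h; apply: Fub; apply: aff_indep_pts_sub h => y [].
have [r [b [r0 b0 br bV bE]]] := linked_seq walk.
exists r, (fun k => basis_set (b k)); rewrite /= b0 br; do 3!split=> //.
split=> [k kr|k kr]; last by apply: crossing_edge; exact: bE.
split; last by apply: triple; exact: bV.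
(* The first basis is in V^eps by hypothesis; each later one is the second end of an edge. *)
case: k kr => [|k] kr; first by rewrite b0; exact: V1.1.
by have [_ [_ []]] := crossing_edge _ _ (bE k kr).
Qed.
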